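(* Let $k$ be an algebraically closed field of characteristic $p>2$, let $\mathbb{H}=k((y^{\mathbb{Q}}))$ be the Hahn field with its valuation $v$, and let $K$ be a field with $k(y)\subseteq K\subseteq\mathbb{H}$ such that $(K,v)$ is Henselian, $K$ is perfect, and $K$ has no finite limits. Let $$\alpha=\sum_{n=1}^\infty y^{-1/p^n},\qquad \theta=\sum_{n=1}^\infty \alpha^{1/p^n},\qquad \eta=\sum_{n=1}^\infty\alpha^{2/p^n}\in\mathbb{H},$$ so that $\alpha^p-\alpha=y^{-1}$, $\theta^p-\theta=\alpha$, $\eta^p-\eta=\alpha^2$. Let $L=K(\alpha)$, $M=L(\eta)$ and $N=L(\theta,\eta)$; the extension $N/K$ is Galois. Then the Galois group of $N/K$ is a non-commutative semidirect product $$\mathrm{Gal}(N/K)\simeq(C_p\times C_p)\rtimes C_p.$$ Moreover, $L/K$ is the unique proper subextension of $M/K$ (i.e. $L$ is the only field $F$ with $K\subsetneq F\subsetneq M$).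
   Context: $\mathbb{H}$ is the field of formal series $s=\sum_{q\in\mathbb{Q}}\lambda_qy^q$, $\lambda_q\in k$, with well-ordered support $\mathrm{supp}(s)=\{q\mid\lambda_q\neq0\}$, and $v(s)=\min\mathrm{supp}(s)$. $K$ has no finite limits if for every $a\in K$ the set $\mathrm{supp}(a)$ has no accumulation point in $\mathbb{R}$ (so $\mathrm{supp}(a)$ is finite or its only limit is $\infty$). $C_p$ denotes the cyclic group of order $p$. *)

(* Defs.v *)
From HB Require Import structures.
From mathcomp Require Import all_boot all_order all_fingroup.
From mathcomp Require Import all_algebra all_solvable all_field.
From mathcomp Require Import boolp classical_sets functions cardinality fsbigop.
From mathcomp Require Import wochoice constructive_ereal reals topology.
From mathcomp Require Import normedtype.

Set Implicit Arguments.
Unset Strict Implicit.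
Unset Printing Implicit Defensive.

Import Order.TTheory GRing.Theory Num.Theory.
Import numFieldNormedType.Exports.

Local Open Scope classical_set_scope.
Local Open Scope ring_scope.

Section WellOrdered.
Implicit Types A B X : set rat.

Definition wo A :=
  forall X, X `<=` A -> X !=set0 -> exists2 m, X m & forall x, X x -> m <= x.

Lemma wo_chainP (C : {pred rat}) : wo_chain <=%R C <-> wo [set` C].
Proof.
split=> [woC X XC [x Xx]|woC].
  have [||m [[/asboolP Xm lb] _]] := woC (fun x => `[< X x >]).
  - by move=> z /asboolP /XC.
  - by exists x; apply/asboolP.
  by exists m => // z Xz; apply: lb; apply/asboolP.
apply: antisymmetric_wo_chain => [x y _ _ /le_anti //|A sAC [x Ax]].
have [||m Am lb] := woC [set` A]; first by move=> z /= Az; apply: sAC.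
  by exists x.
by exists m; split.
Qed.

Lemma wo_sub A B : A `<=` B -> wo B -> wo A.
Proof. by move=> AB woB X XA; apply: woB; apply: subset_trans AB. Qed.

Lemma wo_set1 a : wo [set a].
Proof. by move=> X Xa [x Xx]; exists x => // y Xy; rewrite (Xa _ Xy) (Xa _ Xx). Qed.

Lemma wo_setU A B : wo A -> wo B -> wo (A `|` B).
Proof.
move=> woA woB X XAB [x Xx].
have [XA|/set0P XA] := eqVneq (X `&` A) set0.
  apply: woB; last by exists x.
  by move=> z Xz; case: (XAB z Xz) => // Az; have : (X `&` A) z by []; rewrite XA.
have [XB|/set0P XB] := eqVneq (X `&` B) set0.
  apply: woA; last by exists x.
  by move=> z Xz; case: (XAB z Xz) => // Az; have : (X `&` B) z by []; rewrite XB.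
have [a [Xa Aa] la] := woA _ (@subIsetr _ X A) XA.
have [b [Xb Bb] lb] := woB _ (@subIsetr _ X B) XB.
have [ab|ba] := leP a b.
  exists a => // z Xz; case: (XAB z Xz) => ?; first exact: la.
  by apply: le_trans ab _; apply: lb.
exists b => // z Xz; case: (XAB z Xz) => ?; last exact: lb.
by apply: le_trans (ltW ba) _; apply: la.
Qed.

Lemma wo_ind A (P : rat -> Prop) : wo A ->
  (forall x, A x -> (forall y, A y -> y < x -> P y) -> P x) ->
  forall x, A x -> P x.
Proof.
move=> woA ih x Ax; apply: contrapT => nPx.
have [|z [Az nPz] lz] := woA (A `&` [set z | ~ P z]) (@subIsetl _ _ _).
  by exists x.
apply: nPz; apply: ih => // y Ay yz; apply: contrapT => nPy.
by have := lz y (conj Ay nPy); rewrite leNgt yz.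
Qed.

Definition addset A B : set rat := [set x | exists a b, [/\ A a, B b & x = a + b]].

Lemma wo_addset A B : wo A -> wo B -> wo (addset A B).
Proof.
move=> woA woB.
have key b : B b -> forall X a, X `<=` addset A B -> A a -> X (a + b) ->
    (forall a' b', A a' -> B b' -> X (a' + b') -> a <= a') ->
    exists2 m, X m & forall x, X x -> m <= x.
  move: b; apply: (wo_ind woB) => b Bb ih X a XAB Aa Xab la.
  have [hb|nb] := pselect (forall x, X x -> a + b <= x); first by exists (a + b).
  have /existsNP [x /not_implyP [Xx /negP]] := nb; rewrite -ltNge => xab.
  pose Y := X `&` [set z | z <= x].
  have [|a1 [Aa1 [b1 Bb1 Y1]] l1] :=
      woA (A `&` [set a' | exists2 b', B b' & Y (a' + b')]) (@subIsetl _ _ _).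
    have [a' [b' [Aa' Bb' xE]]] := XAB _ Xx.
    by exists a'; split=> //; exists b' => //; split; rewrite -xE //=.
  have b1b : b1 < b.
    rewrite -(ltrD2l a); apply: le_lt_trans xab; case: Y1 => X1 /=.
    by apply: le_trans; rewrite lerD2r; apply: la X1.
  have [|a' b' Aa' Bb' Y'|m [Xm mx] lm] := ih b1 Bb1 b1b Y a1 _ Aa1 Y1.
  - by move=> z [/XAB].
  - by apply: l1; split=> //; exists b'.
  exists m => // z Xz; have [zx|xz] := leP z x; first exact: lm.
  exact: le_trans mx (ltW xz).
move=> X XAB [x Xx].
have [|a [Aa [b Bb Xab]] la] :=
    woA (A `&` [set a' | exists2 b', B b' & X (a' + b')]) (@subIsetl _ _ _).
  have [a' [b' [Aa' Bb' xE]]] := XAB _ Xx.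
  by exists a'; split=> //; exists b' => //; rewrite -xE.
apply: (key b Bb X a) => // a' b' Aa' Bb' Xab'.
by apply: la; split=> //; exists b'.
Qed.

Lemma wo_finite_sub A B q : wo A -> wo B ->
  finite_set [set a | A a /\ B (q - a)].
Proof.
move=> woA woB; set C := [set a | _].
have woC : wo C by apply: wo_sub woA => x [].
have dwoC X : X `<=` C -> X !=set0 -> exists2 m, X m & forall x, X x -> x <= m.
  move=> XC [x Xx].
  have [||m [z Xz <-] lm] := woB [set q - z | z in X].
  - by move=> _ [z /XC[_ ?] <-].
  - by exists (q - x), x.
  exists z => // y Xy; rewrite -lerN2 -(lerD2l q).
  by apply: lm; exists y.
have fin x : C x -> finite_set (C `&` [set z | z <= x]).
  move: x; apply: (wo_ind woC) => x Cx ih.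
  have [e|/set0P e] := eqVneq (C `&` [set z | z < x]) set0.
    apply: (@sub_finite_set _ _ [set x]) => //.
    move=> z [Cz] /=; rewrite le_eqVlt => /orP[/eqP //|zx].
    by have : (C `&` [set z | z < x]) z by []; rewrite e.
  have [m [Cm mx] lm] := dwoC _ (@subIsetl _ _ _) e.
  apply: (@sub_finite_set _ _ ((C `&` [set z | z <= m]) `|` [set x])).
    move=> z [Cz] /=; rewrite le_eqVlt => /orP[/eqP ->|zx]; first by right.
    by left; split=> //; apply: lm.
  by rewrite finite_setU; split=> //; apply: ih.
have [->//|/set0P e] := eqVneq C set0.
have [m Cm lm] := dwoC _ (@subset_refl _ _) e.
by apply: sub_finite_set (fin m Cm) => z Cz; split=> //; apply: lm.
Qed.

Section Monoid.
Variables (S : set rat).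
Hypotheses (woS : wo S) (S0 : forall s, S s -> 0 < s).

Let T n := iter n (addset S) [set 0].

Definition addmonoid : set rat := \bigcup_n T n.

Lemma addmonoid0 : addmonoid 0.
Proof. by exists 0%N. Qed.

Lemma addmonoidD s t : S s -> addmonoid t -> addmonoid (s + t).
Proof. by move=> Ss [n _ Tt]; exists n.+1 => //; exists s, t. Qed.

Lemma wo_addmonoid : wo addmonoid.
Proof.
have woT n : wo (T n).
  by elim: n => [|n ih]; [exact: wo_set1 | exact: wo_addset].
have [s0 s00 ls0] : exists2 s0, 0 < s0 & forall s, S s -> s0 <= s.
  have [->|/set0P e] := eqVneq S set0; first by exists 1.
  have [m Sm lm] := woS (@subset_refl _ _) e.
  by exists m => //; apply: S0.
have leT n x : T n x -> s0 *+ n <= x.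
  elim: n x => [x ->|n ih x [s [t [Ss Tt ->]]]]; first by rewrite mulr0n.
  by rewrite mulrS lerD ?ls0 ?ih.
move=> X XT [x Xx].
pose N := (Num.bound `|x / s0|).
have xN : x < s0 *+ N.
  rewrite -mulr_natl -ltr_pdivrMr //; apply: le_lt_trans (ler_norm _) _.
  by apply: archi_boundP.
have woN n : wo [set z | exists2 i, (i < n)%N & T i z].
  elim: n => [|n ih]; first by apply: wo_sub (@wo_set1 0) => z [].
  apply: wo_sub (wo_setU ih (woT n)) => z [i].
  by rewrite ltnS leq_eqVlt => /orP[/eqP ->|ni] Ti; [right|left; exists i].
have [||m [Xm mx] lm] := woN N (X `&` [set z | z <= x]).
- move=> z [/XT [i _ Ti] zx]; exists i => //; rewrite ltnNge.
  apply/negP => Ni; have := lt_le_trans xN (ler_wpMn2l (ltW s00) Ni).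
  by rewrite ltNge (le_trans (leT _ _ Ti) zx).
- by exists x; split=> //=.
exists m => // z Xz; have [zx|xz] := leP z x; first exact: lm.
exact: le_trans mx (ltW xz).
Qed.

End Monoid.
End WellOrdered.

Lemma finite_uniq_seq (T : choiceType) (A : set T) : finite_set A ->
  exists2 r : seq T, uniq r & forall a, A a -> a \in r.
Proof.
move=> /finite_seqP [s ->]; exists (undup s); first exact: undup_uniq.
by move=> a; rewrite /= mem_undup.
Qed.

Section Hahn.
Variable k : fieldType.

Definition wo_support : pred (rat -> k) :=
  fun f => `[< wo_chain <=%R (support f) >].

Record hahn := Hahn { hcoef :> rat -> k; _ : wo_support hcoef }.

HB.instance Definition _ := [isSub of hahn for hcoef].
HB.instance Definition _ := [Choice of hahn by <:].

Definition supp (f : rat -> k) : set rat := [set q | f q != 0].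

Lemma wo_supportP (f : rat -> k) : wo_support f <-> wo (supp f).
Proof.
by rewrite /wo_support; split => [/asboolP/wo_chainP|?]; last exact/asboolP/wo_chainP.
Qed.

Lemma wo_support_zmod_closed : zmod_closed wo_support.
Proof.
split=> [|f g].
  by apply/wo_supportP; apply: wo_sub (@wo_set1 0) => q; rewrite /supp /= eqxx.
move=> /wo_supportP wf /wo_supportP wg; apply/wo_supportP.
apply: wo_sub (wo_setU wf wg) => q /= fg0; apply: contrapT => /not_orP[].
move=> /negP/negPn/eqP f0 /negP/negPn/eqP g0.
by case/negP: fg0; apply/eqP; rewrite -[LHS]/(f q - g q) f0 g0 subr0.
Qed.

HB.instance Definition _ :=
  GRing.isZmodClosed.Build (rat -> k) wo_support wo_support_zmod_closed.
HB.instance Definition _ := [SubChoice_isSubZmodule of hahn by <:].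

Implicit Types f g h : hahn.

Lemma hahnP f g : (forall q, f q = g q) -> f = g.
Proof. by move=> fg; apply/val_inj/funext. Qed.

Lemma hcoefD f g q : (f + g) q = f q + g q. Proof. by []. Qed.
Lemma hcoefN f q : (- f) q = - f q. Proof. by []. Qed.
Lemma hcoef0 q : (0 : hahn) q = 0. Proof. by []. Qed.

Lemma wo_supp f : wo (supp f).
Proof. exact/wo_supportP/(valP f). Qed.

(* The sum over the whole of [rat] is the sum over the finitely many [a] such
   that [f a * g (q - a)] is nonzero; see [finite_mul]. *)
Definition mul_coef (f g : rat -> k) (q : rat) : k :=
  \sum_(a \in [set: rat]) f a * g (q - a).

Lemma mul_coefE (f g : rat -> k) q r : uniq r ->
    (forall a, f a != 0 -> g (q - a) != 0 -> a \in r) ->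
  mul_coef f g q = \sum_(a <- r) f a * g (q - a).
Proof.
move=> ur sr; rewrite [RHS]fsbig_seq //; apply/esym/fsbig_widen => // a [_ /= nr].
apply/eqP; apply: contra_notT nr; rewrite mulf_eq0 negb_or => /andP[? ?].
exact: sr.
Qed.

Lemma finite_mul f g q : exists2 r, uniq r &
  forall a, f a != 0 -> g (q - a) != 0 -> a \in r.
Proof.
have [r ur sr] := finite_uniq_seq (wo_finite_sub q (@wo_supp f) (@wo_supp g)).
by exists r => // a fa ga; apply: sr.
Qed.

Lemma supp_mul f g : supp (mul_coef f g) `<=` addset (supp f) (supp g).
Proof.
move=> q /(@fsbigN1 _ _ _ _ _ _ (fun q a => f a * g (q - a))) [a _].
rewrite mulf_eq0 negb_or => /andP[fa ga]; exists a, (q - a).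
by split=> //; rewrite [RHS]addrC subrK.
Qed.

Lemma wo_support_mul f g : wo_support (mul_coef f g).
Proof.
by apply/wo_supportP; apply: wo_sub (@supp_mul f g) _; apply: wo_addset; apply: wo_supp.
Qed.

Definition hmul f g : hahn := Hahn (wo_support_mul f g).

Lemma wo_support_monomial (c : k) (a : rat) :
  wo_support (fun q => if q == a then c else 0).
Proof.
apply/wo_supportP; apply: wo_sub (@wo_set1 a) => q; rewrite /supp /=.
by have [->|_] := eqVneq q a; rewrite ?eqxx.
Qed.

(* c y^a *)
Definition monomial (c : k) (a : rat) : hahn := Hahn (wo_support_monomial c a).

Lemma hmulC : commutative hmul.
Proof.
move=> f g; apply: hahnP => q /=; have [r ur sr] := finite_mul f g q.
rewrite (mul_coefE ur sr) (@mul_coefE g f q [seq q - a | a <- r]).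
- by rewrite big_map; apply: eq_bigr => a _; rewrite mulrC subKr.
- by rewrite map_inj_uniq // => a b /addrI/oppr_inj.
- move=> a ga fa; apply/mapP; exists (q - a); last by rewrite subKr.
  by apply: sr; rewrite ?subKr.
Qed.

Lemma hmulDl : left_distributive hmul +%R.
Proof.
move=> f g h; apply: hahnP => q; rewrite hcoefD /=.
have [r1 u1 s1] := finite_mul f h q; have [r2 u2 s2] := finite_mul g h q.
pose r := undup (r1 ++ r2); have ur : uniq r by apply: undup_uniq.
rewrite !(@mul_coefE _ _ _ r) // => [|a ga ha|a fa ha|a fga ha].
- by rewrite -big_split; apply: eq_bigr => a _; rewrite -[RHS]mulrDl.
- by rewrite mem_undup mem_cat s2 ?orbT.
- by rewrite mem_undup mem_cat s1.
- rewrite mem_undup mem_cat; have [fa|fa] := eqVneq (f a) 0; last by rewrite s1.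
  by rewrite s2 ?orbT //; move: fga; rewrite -[X in X != 0]/(f a + g a) fa add0r.
Qed.

Lemma hmul1 : left_id (monomial 1 0) hmul.
Proof.
move=> f; apply: hahnP => q /=; rewrite (@mul_coefE _ _ _ [:: 0]) //.
  by rewrite big_seq1 eqxx mul1r subr0.
by move=> a; have [->|_] := eqVneq a 0; rewrite ?inE ?eqxx.
Qed.

Lemma hmulA : associative hmul.
Proof.
move=> f g h; apply: hahnP => q.
have [rA uA sA] := finite_uniq_seq
  (wo_finite_sub q (@wo_supp f) (wo_addset (@wo_supp g) (@wo_supp h))).
have [rB uB sB] := finite_uniq_seq
  (wo_finite_sub q (wo_addset (@wo_supp f) (@wo_supp g)) (@wo_supp h)).
transitivity (\sum_(a <- rA) \sum_(b <- rB) f a * (g (b - a) * h (q - b))).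
  rewrite [LHS](@mul_coefE _ _ _ rA) // => [|a fa /supp_mul gha]; last exact: sA.
  apply: eq_bigr => a _; have [->|fa] := eqVneq (f a) 0.
    by rewrite mul0r big1 // => b _; rewrite mul0r.
  rewrite -big_distrr /=; congr (_ * _).
  rewrite (@mul_coefE _ _ _ [seq b - a | b <- rB]).
  - by rewrite big_map; apply: eq_bigr => b _; rewrite opprB addrA subrK.
  - by rewrite map_inj_uniq // => b c /addIr.
  - move=> c gc hc; apply/mapP; exists (c + a); last by rewrite addrK.
    apply: sB; split; last by rewrite /supp /= opprD addrA addrAC.
    by exists a, c; rewrite addrC.
rewrite exchange_big [RHS](@mul_coefE _ _ _ rB) //= => [|b /supp_mul fgb hb].
  apply: eq_bigr => b _; have [->|hb] := eqVneq (h (q - b)) 0.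
    by rewrite mulr0 big1 // => a _; rewrite !mulr0.
  rewrite (@mul_coefE _ _ _ rA) // => [|a fa gb].
    by rewrite big_distrl /=; apply: eq_bigr => a _; rewrite mulrA.
  apply: sA; split=> //; exists (b - a), (q - b); split=> //.
  by rewrite [RHS]addrC subrKA.
exact: sB.
Qed.

Lemma hone_neq0 : monomial 1 0 != 0.
Proof.
apply/eqP => /(congr1 (fun f : hahn => f 0)); rewrite /= => e; have := oner_neq0 k.
by rewrite e eqxx.
Qed.

HB.instance Definition _ :=
  GRing.Zmodule_isComNzRing.Build hahn hmulA hmulC hmul1 hmulDl hone_neq0.

Lemma hmul_ex f : f != 0 -> exists g, g * f = 1.
Proof.
move=> f0; have [m fm lm] : exists2 m, supp f m & forall x, supp f x -> m <= x.
  apply: (@wo_supp f); first by [].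
  apply/set0P; apply: contra_neq f0 => s0; apply: hahnP => q.
  apply: contrapT => /eqP fq; have : supp f q by [].
  by rewrite s0.
pose S : set rat := [set s | 0 < s /\ f (m + s) != 0]; pose T := addmonoid S.
have woS : wo S.
  move=> X XS [x Xx].
  have [||_ [z Xz <-] lz] := @wo_supp f [set m + s | s in X].
  - by move=> _ [s /XS[_ ?] <-].
  - by exists (m + x), x.
  by exists z => // s Xs; rewrite -(lerD2l m); apply: lz; exists s.
have S0 s : S s -> 0 < s by case.
have woT : wo T by apply: wo_addmonoid.
pose R (x y : rat) := T x /\ x < y.
have wfR : well_founded R.
  have acc x : T x -> Acc R x.
    move: x; apply: (wo_ind woT) => x Tx ih.
    by constructor => y [Ty yx]; apply: ih.
  by move=> x; constructor => y [Ty _]; apply: acc.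
pose step (q : rat) (rec : forall y, R y q -> k) : k :=
  if pselect (T q) then (q == 0)%:R - (f m)^-1 * \sum_(s \in S)
     f (m + s) * (if pselect (R (q - s) q) is left e then rec _ e else 0)
  else 0.
pose h := Fix wfR (fun _ => k) step.
have hE q : h q = step q (fun y _ => h y).
  rewrite /h Fix_eq // => x u v uv; congr (step _ _).
  by apply/functional_extensionality_dep => y; apply/funext => e; apply: uv.
have hT q : ~ T q -> h q = 0 by move=> nT; rewrite hE /step; case: pselect.
have hsupp : supp h `<=` T.
  move=> q /= hq; apply: contrapT => /hT h0; move: hq.
  by rewrite /supp /= h0 eqxx.
have woh : wo_support (fun q => (f m)^-1 * h (q + m)).
  apply/wo_supportP => X Xh [x Xx].
  have [||_ [z Xz <-] lz] := woT [set x + m | x in X].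
  - move=> _ [z /Xh + <-]; rewrite /supp /= mulf_eq0 negb_or => /andP[_].
    exact: hsupp.
  - by exists (x + m), x.
  by exists z => // y Xy; rewrite -(lerD2r m); apply: lz; exists y.
have hrec q : h q + (f m)^-1 * \sum_(s \in S) f (m + s) * h (q - s) = (q == 0)%:R.
  have [Tq|nTq] := pselect (T q).
    rewrite {1}hE /step; case: (pselect (T q)) => //= _.
    set X := (X in _ - _ * X + _); set Y := (Y in _ + _ * Y).
    suff -> : X = Y by rewrite subrK.
    apply: eq_fsbigr => s /set_mem Ss; congr (_ * _).
    case: pselect => // nR; apply/esym/hT => Tqs; apply: nR; split=> //.
    by rewrite ltrBlDr ltrDl; apply: S0.
  rewrite hT // fsbig1 ?mulr0 ?addr0 => [|s Ss].
    by case: eqP => // q0; case: nTq; rewrite q0; apply: addmonoid0.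
  rewrite hT ?mulr0 // => Tqs; apply: nTq.
  by rewrite -(subrK s q) addrC; apply: addmonoidD.
exists (Hahn woh); rewrite mulrC; apply: hahnP => q.
have [r ur sr] := finite_mul f (Hahn woh) q.
pose r' := undup (m :: r).
have ur' : uniq r' by apply: undup_uniq.
have mr' : m \in r' by rewrite mem_undup inE eqxx.
have sr' a : f a != 0 -> Hahn woh (q - a) != 0 -> a \in r'.
  by move=> fa ha; rewrite mem_undup inE sr ?orbT.
rewrite [LHS](mul_coefE ur' sr') /= (bigD1_seq m) //= subrK.
have -> : f m * ((f m)^-1 * h q) = h q by rewrite mulrA divff ?mul1r.
rewrite -[if _ then _ else _]/((if q == 0 then 1 else 0) : k).
have -> : (if q == 0 then 1 else 0 : k) = (q == 0)%:R by case: eqP.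
rewrite -(hrec q); congr (_ + _).
rewrite -big_filter.
pose r2 := [seq a - m | a <- r' & a != m].
have ur2 : uniq r2 by rewrite map_inj_uniq ?filter_uniq // => a b /addIr.
pose F s := f (m + s) * h (q - s).
have -> : \sum_(s \in S) F s = \sum_(s <- r2) F s.
  rewrite [RHS]fsbig_seq // (fsbig_widen S (S `|` [set` r2])) //; last first.
    move=> s [[//|/= /mapP[a]]]; rewrite mem_filter => /andP[am _] -> nS.
    have e : m + (a - m) = a by rewrite addrC subrK.
    rewrite /F /= e; suff -> : f a = 0 by rewrite mul0r.
    apply: contrapT => /eqP fa; apply: nS; split; rewrite ?e //.
    by rewrite subr_gt0 lt_neqAle eq_sym am lm.
  apply/esym/fsbig_widen => // s [[Ss|//] /= nr].
  apply/eqP; apply: contra_notT nr; rewrite mulf_eq0 negb_or => /andP[fs hs].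
  apply/mapP; exists (m + s); last by rewrite addrC addKr.
  rewrite mem_filter; apply/andP; split.
    by rewrite -subr_eq0 addrC addKr gt_eqF // S0.
  apply: sr' => //; rewrite /= mulf_neq0 ?invr_eq0 //.
  by rewrite opprD addrA addrAC subrK.
rewrite big_map big_distrr /=; apply: eq_bigr => a _.
by rewrite /F (addrC m) subrK opprB mulrCA addrA addrAC.
Qed.

Definition hinv f : hahn := if f == 0 then 0 else xget 0 [set g | g * f = 1].

Lemma hmulV f : f != 0 -> hinv f * f = 1.
Proof.
move=> f0; rewrite /hinv (negPf f0); have [g gf] := hmul_ex f0.
by case: xgetP => [_ -> //|/(_ g)].
Qed.

Lemma hinv0 : hinv 0 = 0.
Proof. by rewrite /hinv eqxx. Qed.

HB.instance Definition _ := GRing.ComNzRing_isField.Build hahn hmulV hinv0.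

End Hahn.

Section Subfields.
Variable F : fieldType.
Implicit Types (S K N : {pred F}).

Definition gen_subfield S : {pred F} :=
  fun x => `[< forall K : divringClosed F, {subset S <= K} -> x \in K >].

Lemma gen_subfield_closed S : divring_closed (gen_subfield S).
Proof.
split=> [|x y|x y].
- by apply/asboolP => K _; rewrite rpred1.
- move=> /asboolP Sx /asboolP Sy; apply/asboolP => K SK.
  by rewrite rpredB ?Sx ?Sy.
- move=> /asboolP Sx /asboolP Sy; apply/asboolP => K SK.
  by rewrite rpred_div ?Sx ?Sy.
Qed.

HB.instance Definition _ S :=
  GRing.isDivringClosed.Build F (gen_subfield S) (gen_subfield_closed S).

(* K(s_1, ..., s_n) *)
Definition adjoin_seq K (s : seq F) : {pred F} := gen_subfield [predU K & s].

HB.instance Definition _ K s := GRing.DivringClosed.on (adjoin_seq K s).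

Definition proper_subset K N := {subset K <= N} /\ ~ {subset N <= K}.

Definition subfield_type (K : divringClosed F) := {x : F | x \in K}.

HB.instance Definition _ (K : divringClosed F) := SubChoice.on (subfield_type K).
HB.instance Definition _ (K : divringClosed F) :=
  [SubChoice_isSubIntegralDomain of subfield_type K by <:].
HB.instance Definition _ (K : divringClosed F) :=
  [SubIntegralDomain_isSubField of subfield_type K by <:].

(* [E], embedded in [F] by [j], is the extension [N] of [K]: it identifies the
   finite-dimensional extensions of [K] inside [F] with the abstract ones for
   which the library defines [galois] and ['Gal(_ / _)]. *)
Definition models_extension (K : divringClosed F) N
    (E : splittingFieldType (subfield_type K)) (j : {rmorphism E -> F}) :=
  (forall a : subfield_type K, j a%:A = val a) /\
  (forall x, x \in N <-> exists e, j e = x).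

Definition perfect_subfield K :=
  forall p, p \in [pchar F] -> forall x, x \in K -> exists2 z, z \in K & z ^+ p = x.

End Subfields.

Arguments subfield_type {F} K.

Definition cyclic_of_order (gT : finGroupType) (p : nat) (A : {set gT}) :=
  cyclic A /\ #|A| = p.

Section HahnTheory.
Variable k : fieldType.
Local Notation H := (hahn k).
Implicit Types (s : H) (K : {pred H}).

Definition hconst (c : k) : H := monomial c 0.

Definition hvar : H := monomial 1 1.

(* y^a *)
Definition hpow (a : rat) : H := monomial 1 a.

(* k(y) *)
Definition rational_functions : {pred H} :=
  gen_subfield (fun x : H => `[< (exists c, x = hconst c) \/ x = hvar >]).

Definition hval s : \bar rat :=
  if s == 0 then +oo%E
  else (xget 0 [set m | supp s m /\ forall q, supp s q -> m <= q])%:E.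

Definition valuation_ring K : {pred H} :=
  fun x => (x \in K) && (0%:E <= hval x)%E.

Definition maximal_ideal K : {pred H} :=
  fun x => (x \in K) && (0%:E < hval x)%E.

(* Simple roots modulo the maximal ideal lift: the polynomials and the points
   have their coefficients in K because [valuation_ring K] is inside K. *)
Definition henselian K :=
  forall (f : {poly H}) (a : H),
    f \is a polyOver (valuation_ring K) -> f \is monic ->
    a \in valuation_ring K ->
    f.[a] \in maximal_ideal K -> f^`().[a] \notin maximal_ideal K ->
  exists b, [/\ b \in valuation_ring K, root f b & b - a \in maximal_ideal K].

Definition no_finite_limits (R : realType) K :=
  forall a, a \in K -> limit_point ((ratr : rat -> R) @` supp a) = set0.

Definition summable (u : nat -> H) :=
  wo (\bigcup_n supp (u n)) /\ forall q, finite_set [set n | u n q != 0].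

(* The sum of a summable family; junk value 0 otherwise. *)
Definition hsum (u : nat -> H) : H :=
  if `[< summable u >] then insubd 0 (fun q => \sum_(n \in [set: nat]) u n q)
  else 0.

Variable p : nat.

(* x^(1/p^n); the root is unique in characteristic p. *)
Definition proot (n : nat) (x : H) : H := xget 0 [set z | z ^+ (p ^ n) = x].

(* The families are indexed from 0, hence the n.+1. *)
Definition alpha : H := hsum (fun n => hpow (- (p ^ n.+1)%:R^-1)).
Definition theta : H := hsum (fun n => proot n.+1 alpha).
Definition eta : H := hsum (fun n => proot n.+1 (alpha ^+ 2)).

End HahnTheory.

Arguments hvar {k}.
Arguments rational_functions : clear implicits.

(* Main.v *)
From HB Require Import structures.
Require Import Defs.
From mathcomp Require Import all_boot all_order all_fingroup.
From mathcomp Require Import all_algebra all_solvable all_field.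
From mathcomp Require Import boolp classical_sets functions cardinality fsbigop.
From mathcomp Require Import reals topology normedtype ring.

(* Write [wp x = x^p - x].  Since Frobenius is additive, it acts on Hahn series by
   [(f^p)(q) = f(q/p)^p], and the sum of the [p^n]-th roots of a series [x] with
   negative support solves [wp s = x].  Comparing coefficients, [wp c = e y^-1]
   with [e] a nonzero constant forces the support of [c] to accumulate at [0],
   so it has no solution in [K].

   An automorphism [g] of [N/K] acts by [alpha -> alpha + n],
   [theta -> theta + b], [eta -> eta + 2 n theta + e] with [n] an integer and
   [b], [e] constants, so [g^p = 1].  If [theta] were in [L], then
   [c = f alpha - theta] would be in [K] for a constant [f] with [wp f = 1], and
   [wp c = f^p y^-1].  Hence some [h] fixes [alpha] and moves [theta]; it does not
   commute with a [g] moving [alpha], as [2 <> 0].  A nonabelian group of exponent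
   [p] has order at least [p^3], while [N] is reached from [K] in three steps of
   degree at most [p]; so all these steps have degree exactly [p].  The same bound
   applied to [Gal(N/F)], for [K < F < M], shows that [alpha] is in [F]. *)

Set Implicit Arguments.
Unset Strict Implicit.
Unset Printing Implicit Defensive.

Import Order.TTheory GRing.Theory Num.Theory.
Import numFieldNormedType.Exports.
Local Open Scope ring_scope.

(** * Frobenius on Hahn series *)

Section HahnFrobenius.
Local Open Scope classical_set_scope.
Variable k : fieldType.
Local Notation H := (hahn k).
Implicit Types (f g : H) (a b q : rat) (c : k).

Lemma hcoefM f g q : (f * g) q = mul_coef f g q. Proof. by []. Qed.

Lemma supp_mulP f g q : (f * g) q != 0 ->
  exists a b, [/\ f a != 0, g b != 0 & q = a + b].
Proof. by move=> /(@supp_mul k f g)[a [b []]]; exists a, b. Qed.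

Lemma monomialE c a q : monomial c a q = if q == a then c else 0.
Proof. by []. Qed.

Lemma monomialM c d a b : monomial c a * monomial d b = monomial (c * d) (a + b).
Proof.
apply: hahnP => q; rewrite hcoefM (@mul_coefE _ _ _ _ [:: a]) //.
  by rewrite big_seq1 !monomialE eqxx subr_eq addrC; case: eqP => //; rewrite mulr0.
by move=> x; rewrite monomialE inE; case: (x =P a) => //= _; rewrite eqxx.
Qed.

Lemma monomialX c a n : monomial c a ^+ n = monomial (c ^+ n) (a *+ n).
Proof. by elim: n => // n ih; rewrite exprS ih monomialM -exprS -mulrS. Qed.

Lemma hconst_is_zmod_morphism : zmod_morphism (@hconst k).
Proof.
move=> c d; apply: hahnP => q; rewrite hcoefD hcoefN /=.
by case: eqP; rewrite ?subr0.
Qed.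

Lemma hconst_is_monoid_morphism : monoid_morphism (@hconst k).
Proof. by split=> // c d; rewrite /hconst monomialM addr0. Qed.

HB.instance Definition _ :=
  GRing.isZmodMorphism.Build k H (@hconst k) hconst_is_zmod_morphism.
HB.instance Definition _ :=
  GRing.isMonoidMorphism.Build k H (@hconst k) hconst_is_monoid_morphism.

Lemma hpowV a : (hpow k a)^-1 = hpow k (- a).
Proof.
have nz_a : hpow k a != 0.
  apply/eqP => /(congr1 (fun f : H => f a)); rewrite monomialE eqxx.
  by move/eqP; rewrite oner_eq0.
by apply: (mulfI nz_a); rewrite divff // monomialM subrr mulr1.
Qed.

Lemma hvarV_coef q : (hvar^-1 : H) q = (q == -1)%:R.
Proof. by rewrite (hpowV 1) monomialE; case: eqP. Qed.

Lemma wo_restrict f (P : set rat) : wo_support (fun q => if `[< P q >] then f q else 0).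
Proof.
apply/wo_supportP; apply: wo_sub (@wo_supp k f) => q.
by rewrite /supp /=; case: ifP => //; rewrite eqxx.
Qed.

Definition hrestrict f (P : set rat) : H := Hahn (wo_restrict f P).

Lemma expr_supp_lt f a n : (forall q, f q != 0 -> q < a) ->
  forall q, (f ^+ n.+1) q != 0 -> q < a *+ n.+1.
Proof.
move=> fa; elim: n => [//|n ih] q; rewrite exprS => /supp_mulP[x [y [fx fy ->]]].
by rewrite mulrS ltrD ?fa ?ih.
Qed.

Lemma expr_supp_gt f a n : (forall q, f q != 0 -> a < q) ->
  forall q, (f ^+ n.+1) q != 0 -> a *+ n.+1 < q.
Proof.
move=> fa; elim: n => [//|n ih] q; rewrite exprS => /supp_mulP[x [y [fx fy ->]]].
by rewrite mulrS ltrD ?fa ?ih.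
Qed.

Variable p : nat.
Hypothesis pcharkp : p \in [pchar k].

Lemma pchar_hahn : p \in [pchar H].
Proof. by rewrite (fmorph_pchar (@hconst k)). Qed.

(* Cut [f] at the exponent [q / p]: since the p-th power is additive, the parts of
   [f] below and above the cut have p-th powers supported below and above [q]. *)
Lemma hahn_Frobenius f q : (f ^+ p) q = f (q / p%:R) ^+ p.
Proof.
have pp := pcharf_prime pcharkp.
have pn : p%:R != 0 :> rat by rewrite pnatr_eq0 -lt0n prime_gt0.
have [n pE] : exists n, p = n.+1 by exists p.-1; rewrite prednK ?prime_gt0.
pose a := q / p%:R; have qE : q = a *+ p by rewrite -mulr_natr divfK.
pose lo := hrestrict f [set x | x < a]; pose hi := hrestrict f [set x | a < x].
have -> : f = lo + monomial (f a) a + hi.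
  apply: hahnP => x; rewrite !hcoefD monomialE /=.
  case: asboolP => /= xa; case: asboolP => /= ax.
  - by have := lt_trans xa ax; rewrite ltxx.
  - by rewrite lt_eqF ?addr0.
  - by rewrite gt_eqF ?add0r.
  - have -> : x = a by apply: le_anti; rewrite !leNgt; apply/andP; split; apply/negP.
    by rewrite eqxx add0r addr0.
have frobD (x y : H) : (x + y) ^+ p = x ^+ p + y ^+ p.
  exact: (pFrobenius_autD_comm pchar_hahn (mulrC x y)).
rewrite !frobD !hcoefD monomialX monomialE -qE eqxx.
have -> : (lo ^+ p) q = 0.
  apply/eqP/negPn/negP; rewrite {1}pE => /expr_supp_lt lt_q.
  have : q < a *+ n.+1.
    by apply: lt_q => x; rewrite /=; case: asboolP => // _; rewrite eqxx.
  by rewrite -pE -qE ltxx.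
have -> : (hi ^+ p) q = 0.
  apply/eqP/negPn/negP; rewrite {1}pE => /expr_supp_gt gt_q.
  have : a *+ n.+1 < q.
    by apply: gt_q => x; rewrite /=; case: asboolP => // _; rewrite eqxx.
  by rewrite -pE -qE ltxx.
have lo0 : lo a = 0 by rewrite /=; case: asboolP; rewrite //= ltxx.
have hi0 : hi a = 0 by rewrite /=; case: asboolP; rewrite //= ltxx.
by rewrite -/a monomialE eqxx lo0 hi0 add0r !addr0 add0r.
Qed.

Lemma hahn_FrobeniusX f n q : (f ^+ (p ^ n)) q = f (q / (p ^ n)%:R) ^+ (p ^ n).
Proof.
elim: n q => [|n ih] q; first by rewrite expn0 !expr1 divr1.
by rewrite expnSr exprM hahn_Frobenius ih exprM natrM invfM mulrA mulrAC.
Qed.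

(* A solution [c] of [c^p - c = e y^-1] has either all coefficients at
   [- p^n] or all coefficients at [- p^-n] (n > 0) nonzero. *)
Lemma no_root_AS_hvarV (R : realType) (c : H) (e : k) : e != 0 ->
  limit_point ((ratr : rat -> R) @` supp c) = set0 ->
  c ^+ p - c <> hconst e * hvar^-1.
Proof.
have pp := pcharf_prime pcharkp.
move=> e0 nolim cE.
have pn : p%:R != 0 :> rat by rewrite pnatr_eq0 -lt0n prime_gt0.
have pXn n : (p ^ n)%:R != 0 :> rat by rewrite natrX expf_neq0.
have pX1 n : (1 < p ^ n.+1)%N by rewrite -(exp1n n.+1) ltn_exp2r ?prime_gt1.
have cq q : c (q / p%:R) ^+ p - c q = if q == -1 then e else 0.
  have := congr1 (fun f : H => f q) cE.
  rewrite hcoefD hcoefN hahn_Frobenius => ->.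
  by rewrite (hpowV 1) monomialM mulr1 add0r monomialE.
(* The coefficient at [-1/p] decides how nonvanishing spreads: from [-1] by multiplying exponents by
   [p], or from [-1/p] by dividing them. *)
have [c1|c1] := eqVneq (c (- p%:R^-1)) 0.
  have cm1 : c (-1) != 0.
    have := cq (-1); rewrite eqxx mulN1r c1 expr0n gtn_eqF ?prime_gt0 // sub0r.
    by move=> E; apply: contra_neq e0 => c0; rewrite -E c0 oppr0.
  have cX n : c (- (p ^ n)%:R) != 0.
    elim: n => [//|n ih]; have := cq (- (p ^ n.+1)%:R).
    rewrite eqr_opp pnatr_eq1 (gtn_eqF (pX1 n)) /= => /eqP.
    rewrite subr_eq0 expnSr natrM -mulNr mulfK // => /eqP <-.
    by rewrite expf_neq0.
  (* The exponents [-p^n] decrease without bound, against well-ordering. *)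
  have [||m cm lm] := @wo_supp k c [set - (p ^ n)%:R | n in [set: nat]].
  - by move=> _ [n _ <-]; apply: cX.
  - by exists (- (p ^ 0)%:R), 0%N.
  case: cm => n _ mE; have := lm (- (p ^ n.+1)%:R) (ex_intro2 _ _ n.+1 I erefl).
  by rewrite -mE lerN2 ler_nat leq_exp2l ?prime_gt1 // ltnn.
have cX n : c (- (p ^ n.+1)%:R^-1) != 0.
  elim: n => [|n ih]; first by rewrite expn1.
  have := cq (- (p ^ n.+1)%:R^-1).
  rewrite eqr_opp invr_eq1 pnatr_eq1 (gtn_eqF (pX1 n)) /= => /eqP.
  rewrite subr_eq0 mulNr -invfM -natrM -expnSr => /eqP E.
  by move: ih; rewrite -E expf_eq0 prime_gt0.
have : limit_point ((ratr : rat -> R) @` supp c) 0.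
  move=> U /nbhs_ballP[d /= d0 dU].
  pose N := Num.bound d^-1.
  have Nd : d^-1 < (p ^ N.+1)%:R.
    apply: lt_trans (archi_boundP _) _; first by rewrite invr_ge0 ltW.
    rewrite ltr_nat; apply: ltn_trans (ltn_expl _ (prime_gt1 pp)) _.
    by rewrite ltn_exp2l ?prime_gt1.
  exists (ratr (- (p ^ N.+1)%:R^-1)); split.
  - by rewrite fmorph_eq0 oppr_eq0 invr_eq0.
  - by exists (- (p ^ N.+1)%:R^-1) => //; apply: cX.
  apply: dU; rewrite /ball /= sub0r !normrN ?rmorphN ?normrN /= fmorphV /= ratr_nat.
  rewrite ger0_norm ?invr_ge0 ?ler0n // invf_plt ?posrE //.
  by rewrite ltr0n expn_gt0 prime_gt0.
by rewrite nolim.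
Qed.

End HahnFrobenius.

(** * Artin-Schreier sums *)

Section HahnClosed.
Local Open Scope classical_set_scope.
Variables (k : closedFieldType) (p : nat).
Local Notation H := (hahn k).
Hypothesis pcharkp : p \in [pchar k].
Implicit Types (f g x : H) (q : rat).

Let pp : prime p := pcharf_prime pcharkp.
Let pn : p%:R != 0 :> rat. Proof. by rewrite pnatr_eq0 -lt0n prime_gt0. Qed.
Let pXn n : (p ^ n)%:R != 0 :> rat. Proof. by rewrite natrX expf_neq0. Qed.

(** A splitting into linear factors over the algebraically closed [k] persists over the Hahn field,
    so no new roots appear there. *)
Lemma hconst_of_root (f : {poly k}) x : f != 0 -> root (map_poly (@hconst k) f) x ->
  exists c, x = hconst c.
Proof.
have [r {1 2}->] := closed_field_poly_normal f.
rewrite scaler_eq0 negb_or => /andP[f0 _].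
rewrite map_polyZ rmorph_prod rootZ ?fmorph_eq0 // => /=.
under eq_bigr do rewrite /= rmorphB /= map_polyX map_polyC /=.
rewrite -(big_map (@hconst k) predT (fun c => 'X - c%:P)) root_prod_XsubC.
by case/mapP => c _ ->; exists c.
Qed.

Lemma hahn_FrobeniusX_inj n : injective (fun x : H => x ^+ (p ^ n)).
Proof.
elim: n => [//|n ih] x y /=; rewrite expnS !exprM => /ih/eqP.
rewrite -subr_eq0 -!(pFrobenius_autE (pchar_hahn pcharkp)).
rewrite -(pFrobenius_autB_comm _ (mulrC x y)) pFrobenius_autE expf_eq0 subr_eq0.
by case/andP => _ /eqP.
Qed.

Lemma root_exp (c : k) : exists d, d ^+ p == c.
Proof.
have [d dE] := @solve_monicpoly k p (fun i => if i == 0%N then c else 0) (prime_gt0 pp).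
exists d; rewrite dE; case: (p) (prime_gt0 pp) => // n _.
rewrite big_ord_recl /= expr0 mulr1 big1 ?addr0 // => i _.
by rewrite /= mul0r.
Qed.

(** Take [p]-th roots of the coefficients and divide the exponents by [p]; the support is only
    rescaled, hence stays well-ordered. *)
Lemma hahn_root_exp x : exists z : H, z ^+ p = x.
Proof.
pose g q : k := xchoose (root_exp (x (q * p%:R))).
have gE q : g q ^+ p = x (q * p%:R) by apply/eqP; apply: (xchooseP (root_exp _)).
have wog : wo_support g.
  apply/wo_supportP => X Xg [t Xt].
  have [||_ [s Xs <-] ls] := @wo_supp k x [set s * p%:R | s in X].
  - move=> _ [s /Xg + <-]; rewrite /supp /= -gE => gs.
    by rewrite expf_neq0.
  - by exists (t * p%:R), t.
  exists s => // r Xr; have := ls (r * p%:R) (ex_intro2 _ _ r Xr erefl).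
  by rewrite ler_pM2r // ltr0n prime_gt0.
exists (Hahn wog); apply: hahnP => q.
by rewrite (hahn_Frobenius pcharkp) /= gE divfK.
Qed.

Lemma prootP n x : proot p n x ^+ (p ^ n) = x.
Proof.
have [z zE] : exists z : H, z ^+ (p ^ n) = x.
  elim: n => [|n [z <-]]; first by exists x.
  by have [w <-] := hahn_root_exp z; exists w; rewrite expnS exprM.
by rewrite /proot; case: xgetP => [_ -> //|/(_ z)].
Qed.

Lemma proot_eq n x z : z ^+ (p ^ n) = x -> proot p n x = z.
Proof. by move=> zx; apply: (@hahn_FrobeniusX_inj n); rewrite /= prootP. Qed.

Lemma proot0 x : proot p 0 x = x.
Proof. exact: proot_eq. Qed.

Lemma prootS n x : proot p n.+1 x ^+ p = proot p n x.
Proof. by apply/esym/proot_eq; rewrite -exprM -expnS prootP. Qed.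

Lemma proot_supp n x q : (proot p n x q != 0) = (x (q * (p ^ n)%:R) != 0).
Proof.
rewrite -{2}(prootP n x) (hahn_FrobeniusX pcharkp) mulfK // expf_eq0.
by rewrite expn_gt0 prime_gt0.
Qed.

(** Lets [alpha] be treated by the same construction as [theta] and [eta], starting from [y^-1]. *)
Lemma proot_hvarV n : proot p n hvar^-1 = hpow k (- (p ^ n)%:R^-1).
Proof.
apply: proot_eq; rewrite /hpow monomialX expr1n -[hvar]/(hpow k 1) hpowV /hpow.
by congr (monomial _ _); rewrite mulNrn -[_^-1 *+ _]mulr_natr mulVf.
Qed.

Lemma hsum_coef (u : nat -> H) q N : summable u ->
  (forall n, (N <= n)%N -> u n q = 0) -> hsum u q = \sum_(n < N) u n q.
Proof.
move=> su uN; rewrite /hsum; case: asboolP => // _; rewrite insubdK; last first.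
  case: su => wou _; apply/wo_supportP; apply: wo_sub wou => r.
  rewrite /supp /= => /(@fsbigN1 _ _ _ _ _ _ (fun r n => u n r))[n _ unr].
  by exists n.
rewrite -(big_mkord predT (fun n => u n q)) [RHS]fsbig_seq ?iota_uniq //.
apply/esym/fsbig_widen => // n [_ /=]; rewrite mem_index_iota /=.
by move/negP; rewrite -leqNgt => /uN.
Qed.

Section ArtinSchreierSum.
Variable x : H.
Hypothesis x_lt0 : forall q, x q != 0 -> q < 0.

(** If [m] is the least exponent of [x], then [t p^n <= q p^n < m] as soon as [p^n > m / q].
    Uniformity in [t <= q] is what the well-ordering of the union of supports requires. *)
Lemma supp_scale_bound q : q < 0 ->
  exists N, forall n t, (N <= n)%N -> t <= q -> x (t * (p ^ n)%:R) = 0.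
Proof.
move=> q0; have [x0|/set0P x0] := eqVneq (supp x) set0.
  exists 0%N => n t _ _; apply/eqP/negPn/negP => xt.
  by have : supp x (t * (p ^ n)%:R) by []; rewrite x0.
have [m xm lm] := @wo_supp k x (supp x) (@subset_refl _ _) x0.
exists (Num.bound (m / q)) => n t Nn tq; apply/eqP/negPn/negP => /lm.
apply/negP; rewrite -ltNge.
have mq0 : 0 <= m / q by apply: mulr_le0; [exact/ltW/x_lt0 | rewrite invr_le0 ltW].
have lt_n : m / q < (p ^ n)%:R.
  apply: lt_le_trans (archi_boundP mq0) _; rewrite ler_nat.
  by apply: leq_trans Nn (ltnW (ltn_expl _ (prime_gt1 pp))).
apply: (@le_lt_trans _ _ (q * (p ^ n)%:R)); first by rewrite ler_wpM2r ?ler0n.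
by rewrite mulrC -ltr_ndivrMr.
Qed.

Let u n := proot p n.+1 x.

Let u_lt0 n q : u n q != 0 -> q < 0.
Proof.
rewrite proot_supp => /x_lt0; rewrite pmulr_llt0 // ltr0n expn_gt0.
by rewrite prime_gt0.
Qed.

Let u_bound q : exists N, forall n, (N <= n)%N -> u n q = 0.
Proof.
have [q0|q0] := ltP q 0; last first.
  by exists 0%N => n _; apply/eqP; apply: contraTT q0 => /u_lt0; rewrite ltNge.
have [N bN] := supp_scale_bound q0; exists N => n Nn.
by apply/eqP; rewrite -[_ == _]negbK proot_supp bN ?eqxx // leqW.
Qed.

Lemma summable_proot : summable u.
Proof.
split=> [X XU [s Xs]|q].
  have s0 : s < 0 by have [n _ /u_lt0] := XU s Xs.
  have [N bN] := supp_scale_bound s0.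
  (* Only the first [N] terms have exponents [<= s], so a least element is found in a finite union
     of well-ordered supports. *)
  have woN : wo [set q | exists2 n, (n < N)%N & u n q != 0].
    elim: (N) => [|M ih]; first by apply: wo_sub (@wo_set1 0) => z [].
    apply: wo_sub (wo_setU ih (@wo_supp k (u M))) => z [n].
    by rewrite ltnS leq_eqVlt => /orP[/eqP ->|nM] un; [right|left; exists n].
  have [||m [Xm ms] lm] := woN (X `&` [set z | z <= s]).
  - move=> z [/XU[n _ un] zs]; exists n => //; rewrite ltnNge; apply/negP => Nn.
    by move: un; rewrite /supp /= proot_supp bN ?eqxx // leqW.
  - by exists s; split=> //=.
  exists m => // z Xz; have [zs|sz] := leP z s; first exact: lm.
  exact: le_trans ms (ltW sz).
have [N bN] := u_bound q.
apply: (@sub_finite_set _ _ `I_N); last exact: finite_II.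
move=> n /= un; rewrite ltnNge; apply: contra un => Nn.
by rewrite bN.
Qed.

Lemma hsum_proot_lt0 q : hsum u q != 0 -> q < 0.
Proof.
have [N bN] := u_bound q; rewrite (hsum_coef summable_proot bN).
by apply: contraNT; rewrite -leNgt => q0; apply/eqP/big1 => n _;
  apply/eqP; apply: contraTT q0 => /u_lt0; rewrite ltNge.
Qed.

Lemma hsum_proot_AS : hsum u ^+ p - hsum u = x.
Proof.
apply: hahnP => q; rewrite hcoefD hcoefN (hahn_Frobenius pcharkp).
have [N bN] := u_bound q; have [M bM] := u_bound (q / p%:R).
(* The sum is cut after [m + 1] terms at [q / p] but after [m] terms at [q]: Frobenius lowers the
   index of each root by one, so the difference leaves only the zeroth root, [x] itself. *)
pose m := maxn N M.
rewrite (@hsum_coef _ _ m.+1 summable_proot) => [|n]; last first.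
  by move=> mn; apply: bM; apply: leq_trans (ltnW mn); apply: leq_maxr.
rewrite (@hsum_coef _ _ m summable_proot) => [|n]; last first.
  by move=> mn; apply: bN; apply: leq_trans mn; apply: leq_maxl.
rewrite -(pFrobenius_autE pcharkp) rmorph_sum /=.
under eq_bigr do rewrite pFrobenius_autE -(hahn_Frobenius pcharkp) prootS.
by rewrite big_ord_recl /= proot0 addrK.
Qed.

End ArtinSchreierSum.

Lemma alpha_lt0_AS : (forall q, alpha k p q != 0 -> q < 0) /\
  alpha k p ^+ p - alpha k p = hvar^-1.
Proof.
have -> : alpha k p = hsum (fun n => proot p n.+1 hvar^-1).
  by congr hsum; apply/funext => n; rewrite proot_hvarV.
have lt0 q : (hvar^-1 : H) q != 0 -> q < 0.
  by rewrite hvarV_coef; case: (q =P -1) => [->|_]; rewrite ?eqxx.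
by split; [apply: hsum_proot_lt0 | apply: hsum_proot_AS].
Qed.

Lemma theta_AS : theta k p ^+ p - theta k p = alpha k p.
Proof. by have [lt0 _] := alpha_lt0_AS; apply: hsum_proot_AS. Qed.

Lemma eta_AS : eta k p ^+ p - eta k p = alpha k p ^+ 2.
Proof.
apply: hsum_proot_AS => q; rewrite expr2 => /supp_mulP[a [b [aa ab ->]]].
have [lt0 _] := alpha_lt0_AS.
by rewrite -[ltRHS](addr0 0) ltrD ?lt0.
Qed.

End HahnClosed.

(** * Groups of exponent p *)

Section ExponentP.
Local Open Scope group_scope.
Variables (gT : finGroupType) (p : nat).
Hypothesis pp : prime p.
Implicit Types G : {group gT}.

Lemma pgroup_expg1 G : {in G, forall g, g ^+ p = 1} -> p.-group G.
Proof.
move=> Gp; rewrite /pgroup; apply/pnatP => // q pq qG.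
have [x Gx oq] := Cauchy pq qG.
have : (#[x] %| p)%N by rewrite order_dvdn Gp.
by rewrite oq dvdn_prime2.
Qed.

(** The order is a power of [p], and groups of order dividing [p^2] are abelian. *)
Lemma card_nonabelian_expg1 G : {in G, forall g, g ^+ p = 1} -> ~~ abelian G ->
  (p ^ 3 <= #|G|)%N.
Proof.
move=> Gp; have pG := pgroup_expg1 Gp.
apply: contraNleq => lt3; apply: (p2group_abelian pG).
move: lt3; rewrite {1}(card_pgroup pG) ltn_exp2l ?prime_gt1 //.
Qed.

(** A central [z] and an [x] outside [<[z]>] generate a [V] of order [p^2], normal because its index
    is [p]. Exponent [p] makes any [s] outside [V] generate a complement of order [p]. *)
Lemma semidirect_p3_expg1 G : {in G, forall g, g ^+ p = 1} -> #|G| = (p ^ 3)%N ->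
  exists A B C : {group gT},
    [/\ cyclic A /\ #|A| = p, cyclic B /\ #|B| = p, cyclic C /\ #|C| = p &
        (A \x B) ><| C = G].
Proof.
move=> Gp oG; have pG := pgroup_expg1 Gp.
have cyc x : x \in G -> x != 1 -> cyclic <[x]> /\ #|<[x]>| = p.
  move=> Gx x1; split; first exact: cycle_cyclic.
  have : (#[x] %| p)%N by rewrite order_dvdn Gp.
  by move/(prime_nt_dvdP pp); apply; rewrite order_eq1.
have tiP x (H : {group gT}) : x \in G -> x \notin H -> H :&: <[x]> = 1.
  move=> Gx Hx; rewrite finset.setIC; apply: prime_TIg; last by rewrite cycle_subG.
  by rewrite (cyc x Gx _).2 //; apply: contraNneq Hx => ->.
have ntG : G :!=: 1 by rewrite -cardG_gt1 oG -(exp1n 3) ltn_exp2r ?prime_gt1.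
have : 'Z(G) != 1 by rewrite (center_nil_eq1 (pgroup_nil pG)).
case/trivgPn => z Zz z1; have Gz := fintype.subsetP (center_sub G) z Zz.
have [_ oz] := cyc z Gz z1.
have [x Gx zx] : exists2 x, x \in G & x \notin <[z]>.
  apply/subsetPn; apply: contraTN isT => /subset_leq_card.
  by rewrite oG oz -{2}(expn1 p) leq_exp2l ?prime_gt1.
have x1 : x != 1 by apply: contraNneq zx => ->.
have [_ ox] := cyc x Gx x1.
have Cxz : <[z]> \subset 'C(<[x]>).
  rewrite cent_cycle cycle_subG; apply/cent1P.
  by have /centerP[_ cGz] := Zz; rewrite /commute cGz.
have tixz : <[x]> :&: <[z]> = 1 by rewrite finset.setIC tiP.
pose V := (<[x]> <*> <[z]>)%G.
have dV : <[x]> \x <[z]> = V by rewrite dprodEY.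
have oV : #|V| = (p ^ 2)%N by rewrite -(dprod_card dV) ox oz.
have sVG : V \subset G by rewrite join_subG !cycle_subG Gx Gz.
have nVG : V <| G.
  apply: (p_maximal_normal pG); apply: p_index_maximal => //.
  by rewrite -divgS // oG oV (expnS p 2) mulnK // expn_gt0 prime_gt0.
have [s Gs Vs] : exists2 s, s \in G & s \notin V.
  apply/subsetPn; apply: contraTN isT => /subset_leq_card.
  by rewrite oG oV leq_exp2l ?prime_gt1.
have s1 : s != 1 by apply: contraNneq Vs => ->.
have [_ os] := cyc s Gs s1.
exists <[x]>%G, <[z]>%G, <[s]>%G; split; try exact: cyc.
have tiVs : V :&: <[s]> = 1 by rewrite tiP.
rewrite dV sdprodE ?tiVs //; last first.
  by rewrite cycle_subG (fintype.subsetP (normal_norm nVG)).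
apply/eqP; rewrite eqEcard mul_subG ?cycle_subG //=.
by rewrite TI_cardMg // oV os oG -expnSr.
Qed.

End ExponentP.

(** * The Galois group of the Artin-Schreier tower *)

Section ArtinSchreier.
Variables (F : fieldType) (p : nat).
Hypothesis pcharFp : p \in [pchar F].
Implicit Types x y : F.

Let pp : prime p := pcharf_prime pcharFp.

(* The Artin-Schreier operator, usually written with a Weierstrass p. *)
Definition wp x := x ^+ p - x.

Lemma wpD x y : wp (x + y) = wp x + wp y.
Proof.
rewrite /wp -!(pFrobenius_autE pcharFp) (pFrobenius_autD_comm _ (mulrC x y)).
by rewrite opprD addrACA.
Qed.

Lemma wpN x : wp (- x) = - wp x.
Proof.
by rewrite /wp -!(pFrobenius_autE pcharFp) pFrobenius_autN opprB opprK addrC.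
Qed.

Lemma wpB x y : wp (x - y) = wp x - wp y.
Proof. by rewrite wpD wpN. Qed.

Lemma natr_expp n : (n%:R : F) ^+ p = n%:R.
Proof. by rewrite -(pFrobenius_autE pcharFp) pFrobenius_aut_nat. Qed.

Lemma wp_nat n : wp n%:R = 0.
Proof. by rewrite /wp natr_expp subrr. Qed.

Lemma wp_natM n x : wp (n%:R * x) = n%:R * wp x.
Proof. by rewrite /wp exprMn natr_expp mulrBr. Qed.

Lemma size_AS_poly (a : F) : size ('X^p - 'X - a%:P : {poly F}) = p.+1.
Proof.
rewrite -addrA size_polyDl ?size_polyXn // -opprD size_polyN.
rewrite size_polyDl ?size_polyX ?ltnS ?prime_gt1 //.
by rewrite size_polyC; case: (a == 0).
Qed.

Lemma natr_pchar_inj (m n : nat) : (m < p)%N -> (n < p)%N ->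
  m%:R = n%:R :> F -> m = n.
Proof.
wlog le_mn : m n / (m <= n)%N.
  by move=> W mp np e; case/orP: (leq_total m n) => ?; [|apply/esym]; apply: W.
move=> mp np /esym/eqP; rewrite -subr_eq0 -natrB // -(dvdn_pcharf pcharFp).
case: (posnP (n - m)) => [/eqP|nm0 /(dvdn_leq nm0)].
  by rewrite subn_eq0 => nm _; apply/eqP; rewrite eqn_leq le_mn.
by rewrite leqNgt (leq_ltn_trans (leq_subr _ _) np).
Qed.

(** The elements [n%:R] with [n < p] are already [p] distinct roots of [X^p - X]. *)
Lemma wp_eq0 x : wp x = 0 -> exists n, x = n%:R.
Proof.
move=> x0; pose q : {poly F} := 'X^p - 'X - 0%:P.
pose rs : seq F := [seq n%:R | n <- iota 0 p].
have urs : uniq rs.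
  rewrite map_inj_in_uniq ?iota_uniq // => m n; rewrite !mem_iota /= !add0n.
  exact: natr_pchar_inj.
have rootq y : root q y = (wp y == 0).
  by rewrite rootE /q !hornerE ?subr0.
have qE : q = lead_coef q *: \prod_(r <- rs) ('X - r%:P).
  apply: all_roots_prod_XsubC; first by rewrite size_AS_poly size_map size_iota.
    by apply/allP => _ /mapP[n _ ->]; rewrite rootq wp_nat.
  by rewrite uniq_rootsE.
have : root q x by rewrite rootq x0.
rewrite qE rootZ ?root_prod_XsubC; first by case/mapP => n _ ->; exists n.
by rewrite lead_coef_eq0 -size_poly_eq0 size_AS_poly.
Qed.

End ArtinSchreier.

(** * Automorphisms and degrees of the tower over an abstract base field *)

Section GaloisTower.
Variables (F : fieldType) (E : splittingFieldType F) (p : nat) (z al th et : E).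
Hypotheses (pcharEp : p \in [pchar E]) (p_gt2 : (2 < p)%N).
Hypotheses (z_base : z \in 1%VS) (wp_al : wp p al = z).
Hypotheses (wp_th : wp p th = al) (wp_et : wp p et = al ^+ 2).
Hypothesis genE : <<<<<<1; al>>; et>>; th>>%VS = fullv.
(** What remains of the Hahn field: solutions of [wp x = n] are constants of [k], and
    [wp c = e y^-1] has no solution in [K] for a nonzero constant [e]. *)
Hypothesis wp_nat_base : forall (x : E) n, wp p x = n%:R -> x \in 1%VS.
Hypothesis al_notin_base : al \notin 1%VS.
Hypothesis no_base_root : forall f c : E, wp p f = 1 -> c \in 1%VS ->
  wp p c <> f ^+ p * z.

Let pp : prime p := pcharf_prime pcharEp.
Local Notation G := 'Gal({:E} / 1)%g.
Implicit Types g h : gal_of {:E}.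

(** In characteristic [p], [x] is separable over [U] once it lies in [U(x^p)]; here
    [x = x^p - wp x]. *)
Lemma separable_wp (U : {subfield E}) (x : E) : wp p x \in U -> separable U <<U; x>>.
Proof.
move=> Ux; rewrite -adjoin_separable_eq (@pcharf_p_separable _ _ _ _ 0 p pcharEp).
have xE : x ^+ (p ^ 1) - wp p x = x by rewrite expn1 /wp opprB addrC subrK.
rewrite -{1}xE rpredB ?memv_adjoin //.
exact: (subvP (subv_adjoin _ _)).
Qed.

Lemma galois_tower : galois 1 {:E}.
Proof.
apply/and3P; split; [exact: sub1v | | exact: normalFieldf].
rewrite -genE; apply: (@separable_trans _ _ <<<<1; al>>; et>>%AS).
  apply: (@separable_trans _ _ <<1; al>>%AS).
    by apply: separable_wp; rewrite wp_al.
  by apply: separable_wp; rewrite wp_et rpredX ?memv_adjoin.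
apply: separable_wp; rewrite wp_th (subvP (subv_adjoin _ _)) //.
by rewrite memv_adjoin.
Qed.

Lemma gal_base g c : c \in 1%VS -> g c = c.
Proof. by case/vlineP => a ->; rewrite linearZ rmorph1. Qed.

Lemma gal_wp g x : wp p (g x) = g (wp p x).
Proof. by rewrite /wp rmorphB rmorphXn. Qed.

(** Since [g] commutes with [wp], displacements solve Artin-Schreier equations: [wp] sends
    [g al - al] to 0, [g th - th] to [n], and [g et - et - 2 n th] to
    [(al + n)^2 - al^2 - 2 n al = n^2]. *)
Lemma gal_action g : exists n b e,
  [/\ b \in 1%VS, wp p b = n%:R & e \in 1%VS] /\
  [/\ g al = al + n%:R, g th = th + b & g et = et + 2 * n%:R * th + e].
Proof.
have [n nE] : exists n, g al - al = n%:R.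
  by apply: (wp_eq0 pcharEp); rewrite (wpB pcharEp) gal_wp wp_al gal_base ?subrr.
have gal : g al = al + n%:R by rewrite -nE addrC subrK.
have wb : wp p (g th - th) = n%:R by rewrite (wpB pcharEp) gal_wp wp_th gal addrC addKr.
have we : wp p (g et - et - 2 * n%:R * th) = (n ^ 2)%:R.
  rewrite !(wpB pcharEp) gal_wp wp_et rmorphXn /= gal -natrM (wp_natM pcharEp) wp_th.
  by rewrite natrX natrM; ring.
exists n, (g th - th), (g et - et - 2 * n%:R * th); split; split => //.
- exact: wp_nat_base wb.
- exact: wp_nat_base we.
- by rewrite addrC subrK.
- by ring.
Qed.

Lemma gal_fix g (U : {subfield E}) (x : E) :
  {in U, forall y, g y = y} -> g x = x -> {in <<U; x>>%VS, forall y, g y = y}.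
Proof.
move=> gU gx y Uxy; have : (<<U; x>> <= fixedField [set g])%VS.
  apply/FadjoinP; split.
    by apply/subvP => u Uu; apply/fixedFieldP => [|h /finset.set1P->]; rewrite ?memvf ?gU.
  by apply/fixedFieldP => [|h /finset.set1P->]; rewrite ?memvf.
by move=> /subvP/(_ y Uxy)/mem_fixedFieldP[_]; apply; rewrite finset.set11.
Qed.

Lemma gal_eq1 g : g al = al -> g et = et -> g th = th -> g = 1%g.
Proof.
move=> ga ge gt; apply/eqP/gal_eqP => x _; rewrite gal_id.
have : x \in <<<<<<1; al>>; et>>; th>>%VS by rewrite genE memvf.
apply: gal_fix gt x; apply: gal_fix ge; apply: gal_fix ga => y.
exact: gal_base.
Qed.

Lemma gal_expp g : (g ^+ p)%g = 1%g.
Proof.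
have [n [b [e [[b1 _ e1] [ga gt ge]]]]] := gal_action g.
(* The accumulated term [2 m n th] contributes [2 m n b] at the next application of [g]; these add
   up to [n b (m^2 - m)], which vanishes at [m = p] with the other corrections. *)
have gX m : [/\ (g ^+ m)%g al = al + m%:R * n%:R, (g ^+ m)%g th = th + m%:R * b
    & (g ^+ m)%g et = et + 2 * m%:R * n%:R * th + n%:R * b * (m%:R ^+ 2 - m%:R)
                      + m%:R * e].
  elim: m => [|m [aE tE eE]]; first by rewrite expg0 !gal_id; split; ring.
  rewrite expgSr !galM ?memvf // aE tE eE !rmorphD !rmorphM /= !rmorphB !rmorphXn /=.
  rewrite !rmorph_nat ga gt ge (gal_base g b1) (gal_base g e1) -natr1.
  by split; ring.
have [aE tE eE] := gX p; rewrite (pcharf0 pcharEp) in aE tE eE.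
apply: gal_eq1; rewrite ?aE ?tE ?eE; ring.
Qed.

Lemma gal_not_commute g h : g al != al -> h al = al -> h th != th ->
  (g * h != h * g)%g.
Proof.
move=> ga_neq ha ht_neq; apply/eqP => gh.
have [n [b [e [[b1 _ e1] [ga gt ge]]]]] := gal_action g.
have [m [b' [e' [[b'1 _ e'1] [ha' ht he]]]]] := gal_action h.
have m0 : m%:R = 0 :> E by apply: (@addrI _ al); rewrite -ha' ha addr0.
have := congr1 (fun g : gal_of _ => g et) gh; rewrite /= !galM ?memvf // ge he.
rewrite m0 mulr0 mul0r addr0 !rmorphD !rmorphM /= !rmorph_nat ht he ge.
rewrite (gal_base h e1) (gal_base g e'1) m0 mulr0 mul0r addr0 => E1.
(* This is the difference of the two products at [et]. *)
have : 2 * n%:R * b' = 0.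
  by move/eqP: E1; rewrite -subr_eq0 => /eqP <-; ring.
move/eqP; rewrite !mulf_eq0 -orbA; case/or3P => /eqP x0.
- have := dvdn_pcharf pcharEp 2; rewrite x0 eqxx => /dvdn_leq => /(_ isT).
  by rewrite leqNgt p_gt2.
- by move: ga_neq; rewrite ga x0 addr0 eqxx.
- by move: ht_neq; rewrite ht x0 addr0 eqxx.
Qed.

Lemma gal_moves (U : {subfield E}) (x : E) : x \notin U ->
  exists2 g, g \in 'Gal({:E} / U)%g & g x != x.
Proof.
move=> Ux; have /galois_fixedField fixU : galois U {:E}.
  by apply: galoisS galois_tower; rewrite sub1v subvf.
apply: contrapT => nog; move: Ux; rewrite -{1}fixU => /negP; apply.
apply/(fixedFieldP (memvf x)) => g Ug; apply: contrapT => /eqP gx.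
by apply: nog; exists g.
Qed.

Lemma gal_moves_al : exists g, g al != al.
Proof. by have [g _ ga] := gal_moves al_notin_base; exists g. Qed.

Lemma th_notin_al : th \notin <<1; al>>%VS.
Proof.
apply/negP => /Fadjoin_polyP[q q1 qE]; have [g0 ga0] := gal_moves_al.
have [n [b [e [[b1 wb _] [ga gt _]]]]] := gal_action g0.
have n0 : n%:R != 0 :> E by apply: contraNneq ga0 => n0; rewrite ga n0 addr0.
have gq g : g th = q.[g al].
  rewrite qE -horner_map (fixedPoly_gal (sub1v _) _ q1) // gal_kHom ?sub1v //.
  by apply/kAHomP => c /gal_base ->.
(* With this [f], [f al] and [th] have the same displacement under [g0]. *)
pose f := b / n%:R.
have wf : wp p f = 1.
  rewrite /wp /f expr_div_n (natr_expp pcharEp) -mulrBl -[_ - b]/(wp p b) wb.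
  by rewrite divff.
have f1 : f \in 1%VS by apply: (@wp_nat_base _ 1).
pose w := th - f * al.
(* The displacements of [al] under [g] and [g0] have a ratio in the prime field, so [g] agrees with
   a power of [g0] on [al], hence on [th = q.[al]]; powers of [g0] fix [w]. *)
have w1 : w \in 1%VS.
  have /galois_fixedField <- := galois_tower; apply/(fixedFieldP (memvf w)) => g _.
  have [n' [b' [_ [_ [ga' _ _]]]]] := gal_action g.
  have [m mE] : exists m, n'%:R / n%:R = m%:R :> E.
    apply: (wp_eq0 pcharEp).
    by rewrite /wp expr_div_n !(natr_expp pcharEp) subrr.
  have g0X i : (g0 ^+ i)%g al = al + i%:R * n%:R /\ (g0 ^+ i)%g th = th + i%:R * b.
    elim: i => [|i [iha iht]]; first by rewrite !gal_id !mul0r !addr0.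
    rewrite expgSr !galM ?memvf // iha iht !rmorphD !rmorphM /= !rmorph_nat ga gt.
    by rewrite (gal_base g0 b1) -natr1; split; ring.
  have [mal mth] := g0X m.
  have gal : g al = (g0 ^+ m)%g al by rewrite mal -mE divfK.
  have gth : g th = (g0 ^+ m)%g th by rewrite !gq gal.
  rewrite /w rmorphB rmorphM /= gth gal mal mth (gal_base g f1) /f.
  by field.
(* As [wp f = 1], [wp (f al) = f^p z + al], so [al] cancels in [wp w] and [- w] is an excluded
   solution. *)
have Nw1 : - w \in 1%VS by rewrite rpredN.
apply: (no_base_root wf Nw1).
rewrite (wpN pcharEp) /w (wpB pcharEp) wp_th.
have -> : wp p (f * al) = f ^+ p * z + al * wp p f.
  by rewrite -wp_al /wp exprMn; ring.
by rewrite wf; ring.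
Qed.

Lemma gal_nonabelian : ~~ abelian G.
Proof.
have [g ga] := gal_moves_al; have [h hL ht] := gal_moves th_notin_al.
have ha : h al = al by apply: fixed_gal (subvf _) hL _; apply: memv_adjoin.
apply/negP => abG; have /eqP := gal_not_commute ga ha ht; apply.
have inG u : u \in G.
  by rewrite gal_kHom ?sub1v //; apply/kAHomP => c /gal_base ->.
by apply: (centsP abG).
Qed.

(** The minimal polynomial of [x] over [U] divides [X^p - X - wp x]. *)
Lemma dim_wp (U : {subfield E}) (x : E) : wp p x \in U ->
  (\dim <<U; x>> <= p * \dim U)%N.
Proof.
move=> Ux; rewrite dim_Fadjoin leq_mul2r; apply/orP; right.
rewrite -ltnS -size_minPoly -(size_AS_poly pcharEp (wp p x)).
apply: dvdp_leq; first by rewrite -size_poly_eq0 (size_AS_poly pcharEp).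
apply: minPoly_dvdp; first by rewrite !rpredB ?rpredX ?polyOverX ?polyOverC.
by rewrite rootE !hornerE subrr.
Qed.

Lemma dim_tower : [/\ \dim <<1; al>> = p, \dim <<<<1; al>>; et>> = (p ^ 2)%N
  & \dim {:E} = (p ^ 3)%N].
Proof.
have leL := @dim_wp 1%AS al; have leM := @dim_wp <<1; al>>%AS et.
have leE := @dim_wp <<<<1; al>>; et>>%AS th.
rewrite wp_al z_base dimv1 muln1 in leL.
rewrite wp_et rpredX ?memv_adjoin // in leM.
rewrite wp_th (subvP (subv_adjoin _ _)) ?memv_adjoin // genE in leE.
have : (p ^ 3 <= \dim {:E})%N.
  have := card_nonabelian_expg1 pp _ gal_nonabelian.
  rewrite -(galois_dim galois_tower) dimv1 divn1; apply => g _; exact: gal_expp.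
move: (leL isT) (leM isT) (leE isT) => {}leL {}leM {}leE ge3.
have p0 := prime_gt0 pp.
have geM : (p ^ 2 <= \dim <<<<1; al>>; et>>)%N.
  by rewrite -(leq_pmul2l p0) -expnS (leq_trans ge3).
have geL : (p <= \dim <<1; al>>)%N by rewrite -(leq_pmul2l p0) (leq_trans geM).
have eL : \dim <<1; al>> = p by apply/eqP; rewrite eqn_leq leL.
have eM : \dim <<<<1; al>>; et>> = (p ^ 2)%N.
  by apply/eqP; rewrite eqn_leq geM (leq_trans leM) // eL.
by split => //; apply/eqP; rewrite eqn_leq ge3 (leq_trans leE) // eM.
Qed.

Lemma gal_semidirect : exists A B C : {group gal_of {:E}},
  [/\ cyclic A /\ #|A| = p, cyclic B /\ #|B| = p, cyclic C /\ #|C| = p &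
      ((A \x B) ><| C = G)%g].
Proof.
apply: semidirect_p3_expg1 => // [g _|]; first exact: gal_expp.
by have [_ _ <-] := dim_tower; rewrite -(galois_dim galois_tower) dimv1 divn1.
Qed.

Lemma et_notin_al : et \notin <<1; al>>%VS.
Proof.
apply/negP => etL; have [dL dM _] := dim_tower.
have : (<<<<1; al>>; et>> <= <<1; al>>)%VS by apply/FadjoinP; split; rewrite ?subvv.
have lt1 : (p < p ^ 2)%N by rewrite -{1}(expn1 p) ltn_exp2l ?prime_gt1.
by move/dimvS; rewrite dL dM leqNgt lt1.
Qed.

Lemma unique_subfield (U : {subfield E}) : (U <= <<<<1; al>>; et>>)%VS ->
  U != 1%VS :> {vspace E} -> U != <<<<1; al>>; et>>%VS :> {vspace E} ->
  U = <<1; al>>%VS :> {vspace E}.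
Proof.
move=> sUM U1 UM; have [dL dM dE] := dim_tower.
have p0 := prime_gt0 pp.
have Gexp (D : {group gal_of {:E}}) : {in D, forall g, g ^+ p = 1}%g.
  by move=> g _; apply: gal_expp.
(* Otherwise [Gal(E/U)] contains a [g] moving [al] and an [h] that fixes [al] and moves [th]; being
   nonabelian it has order at least [p^3], the degree of [E], which forces [U = 1]. *)
have alU : al \in U.
  apply: contraNT U1 => /gal_moves[g gU ga].
  have thM : th \notin <<<<1; al>>; et>>%VS.
    apply/negP => thM; move: dE; rewrite -genE.
    have -> : <<<<<<1; al>>; et>>; th>>%VS = <<<<1; al>>; et>>%VS.
      by apply/eqP; rewrite eqEsubv subv_adjoin andbT; apply/FadjoinP; split.
    by rewrite dM => /eqP; rewrite eqn_exp2l ?prime_gt1.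
  have [h hM ht] := gal_moves thM.
  have ha : h al = al.
    by apply: fixed_gal (subvf _) hM _; rewrite (subvP (subv_adjoin _ _)) ?memv_adjoin.
  have hU : h \in 'Gal({:E} / U)%g by apply: fintype.subsetP hM; apply: galS.
  have : ~~ abelian 'Gal({:E} / U)%g.
    apply/negP => abU; have /eqP := gal_not_commute ga ha ht; apply.
    exact: (centsP abU).
  move/(card_nonabelian_expg1 pp (Gexp _)).
  have galU : galois U {:E} by apply: galoisS galois_tower; rewrite sub1v subvf.
  rewrite -(galois_dim galU) dE => le3.
  rewrite eq_sym eqEdim sub1v dimv1.
  have := divnK (field_dimS (subvf U)); rewrite dE => dvE.
  rewrite -(leq_pmul2l (leq_trans _ le3)) ?expn_gt0 ?p0 // dvE muln1.
  exact: le3.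
apply/esym/eqP; rewrite eqEdim; apply/andP; split.
  by apply/FadjoinP; split; rewrite ?sub1v.
have /(dvdn_pfactor _ _ pp)[[|[|[|m]]] // m2 dU] : (\dim U %| p ^ 2)%N.
- by rewrite -dM; apply: field_dimS.
- by rewrite dU dL (leq_trans _ (prime_gt0 pp)).
- by rewrite dU dL.
- by move: UM; rewrite eqEdim sUM dM dU leqnn.
Qed.

End GaloisTower.

(** * Splitting of the tower *)

Section AlphaNorm.
Variables (F : fieldType) (p : nat).
Hypotheses (pcharFp : p \in [pchar F]) (p_gt2 : (2 < p)%N).

Let pp : prime p := pcharf_prime pcharFp.

Definition wpX : {poly F} := 'X^p - 'X.

Lemma size_wpX : size wpX = p.+1.
Proof. by have := size_AS_poly pcharFp 0; rewrite polyC0 subr0. Qed.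

(** An equation of [theta] over the base, from [wp (wp theta) = wp alpha = z]. *)
Definition theta_poly (z : F) : {poly F} := wpX ^+ p - wpX - z%:P.

Lemma theta_polyE z x : (theta_poly z).[x] = wp p (wp p x) - z.
Proof. by rewrite /theta_poly /wpX /wp !hornerE. Qed.

Lemma separable_theta_poly z : separable_poly (theta_poly z).
Proof.
have pcharX : p \in [pchar {poly F}] by apply: rmorph_pchar pcharFp; exact: polyC.
have dW : wpX^`() = -1 by rewrite derivB derivXn derivX (mulrn_pchar pcharX) sub0r.
rewrite separable_poly.unlock.
have -> : (theta_poly z)^`() = 1.
  by rewrite 2!derivB derivC deriv_exp dW (mulrn_pchar pcharX) subr0 sub0r opprK.
exact: coprimep1.
Qed.

(* [wp alpha = z] gives [(alpha^2)^p - 2 (alpha^2)^((p+1)/2) + alpha^2 = z^2]; this is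
   the resulting equation for [alpha^2], evaluated at [X^p - X]. *)
Definition eta_poly (z : F) : {poly F} :=
  wpX ^+ p - wpX ^+ p.+1./2 *+ 2 + wpX - (z ^+ 2)%:P.

Lemma size_eta_poly z : size (eta_poly z) = (p ^ 2).+1.
Proof.
have sX n : size (wpX ^+ n) = (p * n).+1.
  have w0 : wpX ^+ n != 0 by rewrite expf_neq0 // -size_poly_eq0 size_wpX.
  by have := size_exp wpX n; rewrite size_wpX /= => <-; rewrite prednK // lt0n size_poly_eq0.
rewrite /eta_poly -2!addrA size_polyDl sX // ltnS.
have half_lt : (p.+1./2 < p)%N.
  by rewrite ltn_half_double -addnn -[p.+1]add1n ltn_add2r (ltn_trans _ p_gt2).
rewrite (leq_trans (size_polyD _ _)) // geq_max; apply/andP; split.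
  rewrite size_polyN mulr2n (leq_trans (size_polyD _ _)) // maxnn sX.
  by rewrite ltn_pmul2l ?prime_gt0.
rewrite (leq_trans (size_polyD _ _)) // geq_max size_wpX size_polyN; apply/andP; split.
  by rewrite -[X in (X < _)%N]muln1 ltn_pmul2l ?prime_gt1 ?prime_gt0.
by rewrite (leq_trans (size_polyC_leq1 _)) // muln_gt0 prime_gt0.
Qed.

Lemma eta_poly_root z s x : wp p s = z -> wp p x = s ^+ 2 ->
  root (eta_poly z) x.
Proof.
move=> sz xs; rewrite rootE /eta_poly /wpX !hornerE -/(wp p x) xs.
(* As [p] is odd, [(s^2)^((p+1)/2) = s^(p+1)], and the value becomes [(s^p - s)^2 - z^2]. *)
have odd_p : odd p by case: (even_prime pp) p_gt2 => // ->.
rewrite -!exprM (mulnC 2 p.+1./2) muln2 halfK /= odd_p /= subn0.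
rewrite -sz.
have -> : x ^+ p = s ^+ 2 + x by rewrite -xs /wp subrK.
by rewrite /wp [(2 * p)%N]mulnC exprM [s ^+ p.+1]exprS; apply/eqP; ring.
Qed.

End AlphaNorm.

Section MapPolys.
Variables (F L : fieldType) (f : {rmorphism F -> L}) (p : nat).

Lemma map_wpX :
  map_poly f (wpX F p) = wpX L p.
Proof. by rewrite /wpX rmorphB /= map_polyXn map_polyX. Qed.

Lemma map_theta_poly z :
  map_poly f (theta_poly p z) = theta_poly p (f z).
Proof. by rewrite /theta_poly 2!rmorphB rmorphXn /= map_wpX map_polyC. Qed.

Lemma map_eta_poly z :
  map_poly f (eta_poly p z) = eta_poly p (f z).
Proof.
rewrite /eta_poly rmorphB rmorphD rmorphB rmorphMn !rmorphXn /=.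
by rewrite map_wpX map_polyC.
Qed.

End MapPolys.

Section Splitting.
Variables (F : fieldType) (E : fieldExtType F) (p : nat) (z al th et u : E).
Hypotheses (pcharEp : p \in [pchar E]) (p_gt2 : (2 < p)%N).
Hypotheses (z_base : z \in 1%VS) (u_base : u \in 1%VS) (wp_u : wp p u = 1).
Hypotheses (wp_al : wp p al = z) (wp_th : wp p th = al) (wp_et : wp p et = al ^+ 2).
Hypothesis genE : <<<<<<1; al>>; et>>; th>>%VS = fullv.
Hypothesis th_notin_base : th \notin 1%VS.

Let pp : prime p := pcharf_prime pcharEp.

(** The expected conjugates of [et]: [wp u = 1] gives them image [(al + c)^2] under [wp], and
    [c, j < p] yield the [p^2] roots of [eta_poly]. *)
Let conj (c j : nat) : E := et + 2 * c%:R * th + c%:R ^+ 2 * u + j%:R.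

Lemma two_neq0 : 2 != 0 :> E.
Proof. by rewrite -(dvdn_pcharf pcharEp) gtnNdvd. Qed.

Let wp_conj c j : wp p (conj c j) = (al + c%:R) ^+ 2.
Proof.
rewrite !(wpD pcharEp) (wp_nat pcharEp) -natrM -natrX !(wp_natM pcharEp).
by rewrite wp_et wp_th wp_u natrX natrM; ring.
Qed.

(** [eta_poly z] alone suffices: its roots [conj c j] recover [th] from the difference of two of
    them, and then [al = wp th]. *)
Lemma splitting_field_tower : SplittingField.axiom E.
Proof.
exists (eta_poly p z).
  by rewrite !(rpredB, rpredD, rpredMn, rpredX, polyOverX, polyOverC).
pose rs := [seq conj c j | c <- iota 0 p, j <- iota 0 p].
have conj_rs c j : (c < p)%N -> (j < p)%N -> conj c j \in rs.
  by move=> cp jp; apply/allpairsP; exists (c, j); rewrite !mem_iota.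
have nat1 n : n%:R \in (1%VS : {vspace E}) by apply: rpred_nat.
have urs : uniq rs.
  apply: allpairs_uniq; rewrite ?iota_uniq // => -[c j] [c' j'].
  case/allpairsP=> -[x y] [/= xp yp [-> ->]] {c j}.
  case/allpairsP=> -[x' y'] [/= x'p y'p [-> ->]] {c' j'}.
  rewrite !mem_iota !add0n /= in xp yp x'p y'p => eq_conj.
  (* Equal values with different [c] would express [th] through [u] and integers, placing it in the
     base. *)
  have xx' : x%:R = x'%:R :> E.
    apply: contraNeq th_notin_base => xx'.
    have d0 : 2 * (x%:R - x'%:R) != 0 :> E by rewrite mulf_neq0 ?two_neq0 ?subr_eq0.
    have -> : th = (2 * (x%:R - x'%:R))^-1
        * ((x'%:R ^+ 2 - x%:R ^+ 2) * u + (y'%:R - y%:R)).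
      apply: (mulfI d0); rewrite mulrA divff // mul1r; apply/eqP.
      by rewrite -subr_eq0; move/eqP: eq_conj; rewrite -subr_eq0 => /eqP <-;
        apply/eqP; rewrite /conj; ring.
    by do !first [exact: nat1 | exact: u_base | rewrite rpredV | apply: rpredX
      | apply: rpredM | apply: rpredB | apply: rpredD].
  move: eq_conj; rewrite /conj /= xx' => /addrI yy'.
  by rewrite (natr_pchar_inj pcharEp xp x'p xx') (natr_pchar_inj pcharEp yp y'p yy').
exists rs.
  have -> : eta_poly p z = lead_coef (eta_poly p z) *: \prod_(r <- rs) ('X - r%:P).
    apply: all_roots_prod_XsubC; last by rewrite uniq_rootsE.
      by rewrite (size_eta_poly pcharEp p_gt2) size_allpairs size_iota mulnn.
    apply/allP => _ /allpairsP[[c j] [_ _ ->]].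
    apply: (eta_poly_root pcharEp p_gt2 _ (wp_conj c j)).
    by rewrite (wpD pcharEp) (wp_nat pcharEp) addr0.
  by rewrite eqp_scale // lead_coef_eq0 -size_poly_eq0 (size_eta_poly pcharEp p_gt2).
apply/eqP; rewrite eqEsubv subvf /= -genE.
have rsE c j : (c < p)%N -> (j < p)%N -> conj c j \in <<1 & rs>>%VS.
  by move=> cp jp; apply: seqv_sub_adjoin; apply: conj_rs.
have base x : x \in 1%VS -> x \in <<1 & rs>>%VS.
  by apply: subvP; apply: sub1v.
have et_rs : et \in <<1 & rs>>%VS.
  have := rsE 0 0 (prime_gt0 pp) (prime_gt0 pp).
  by rewrite /conj mulr0 mul0r expr0n mul0r !addr0.
have th_rs : th \in <<1 & rs>>%VS.
  have -> : th = 2^-1 * (conj 1 0 - et - u).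
    by apply: (mulfI two_neq0); rewrite mulrA divff ?two_neq0 // mul1r /conj; ring.
  have := rsE 1 0 (prime_gt1 pp) (prime_gt0 pp) => c10.
  by rewrite rpredM ?rpredV ?rpredB ?(base u) ?(base 2).
have al_rs : al \in <<1 & rs>>%VS by rewrite -wp_th /wp rpredB ?rpredX.
apply/FadjoinP; split=> //; apply/FadjoinP; split=> //; apply/FadjoinP; split=> //.
exact: sub1v.
Qed.

End Splitting.

(** * Abstract extensions as models of subfields *)

Lemma primitive_model (F L : fieldType) (iota : {rmorphism F -> L}) (x : L) :
  algebraicOver iota x ->
  exists (E : fieldExtType F) (j : {rmorphism E -> L}) (g : E),
    [/\ forall a, j a%:A = iota a, j g = x & <<1; g>>%VS = fullv].
Proof.
case=> q0 nz_q0 q0x.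
(* A nonzero polynomial of least size vanishing at [x] is irreducible; formally adjoining a root of
   it gives a field embedded in [L]. *)
pose P n := `[< exists q : {poly F}, [/\ q != 0, root (map_poly iota q) x & size q = n] >].
have exP : exists n, P n by exists (size q0); apply/asboolP; exists q0.
case: (ex_minnP exP) => n /asboolP[q [nz_q qx sq]] min_n.
have irr_q : irreducible_poly q.
  apply/(subfx_irreducibleP qx nz_q) => r rx nz_r; rewrite sq.
  by apply: min_n; apply/asboolP; exists r.
exists (SubFieldExtType qx irr_q), (@subfx_inj _ _ iota x q).
exists (subfx_root iota x q); split.
- exact: (subfx_inj_base qx nz_q).
- exact: subfx_inj_root.
apply/eqP; rewrite eqEsubv subvf /=; apply/subvP => y _.
have [r ->] := subfxEroot qx nz_q y.
apply: mempx_Fadjoin; apply/polyOverP => i; rewrite coef_map /=.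
by apply/vlineP; exists r`_i.
Qed.

Section Models.
Variables (L : fieldType) (K : divringClosed L).
Variables (E : fieldExtType (subfield_type K)) (j : {rmorphism E -> L}).
Hypothesis j_base : forall a : subfield_type K, j a%:A = val a.

Definition represents (U : {vspace E}) (S : {pred L}) :=
  forall x, x \in S <-> exists2 e, e \in U & j e = x.

Lemma represents_mem U S e : represents U S -> (j e \in S) <-> (e \in U).
Proof.
move=> US; split=> [/US[e' Ue' /fmorph_inj <-] //|Ue].
by apply/US; exists e.
Qed.

Lemma represents_base : represents 1%VS K.
Proof.
move=> x; split=> [Kx|[_ /vlineP[a ->] <-]]; last by rewrite j_base; apply: valP.
exists (Sub x Kx : subfield_type K)%:A; last by rewrite j_base.
by apply/vlineP; exists (Sub x Kx).
Qed.

Lemma sub_represents U V S T : represents U S -> represents V T ->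
  {subset S <= T} <-> (U <= V)%VS.
Proof.
move=> US VT; split=> [ST|UV x /US[e Ue <-]].
  by apply/subvP => e /(represents_mem _ US)/ST/(represents_mem _ VT).
by apply/(represents_mem _ VT)/(subvP UV).
Qed.

(** Take a subspace of largest dimension with image inside [S]. Adding the line of any [e] with
    [j e] in [S] keeps the image in [S], so by maximality [e] was already there. *)
Lemma preimage_subfield (S : divringClosed L) : {subset K <= S} ->
  exists U : {subfield E}, forall e, (e \in U) <-> (j e \in S).
Proof.
move=> KS.
pose P n := `[< exists U : {vspace E}, {subset U <= [pred e | j e \in S]} /\ \dim U = n >].
have S1 e : e \in 1%VS -> j e \in S.
  by case/vlineP => a ->; rewrite j_base; apply: KS; apply: valP.
have exP : exists n, P n.
  exists (\dim (1%VS : {vspace E})); by apply/asboolP; exists 1%VS.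
have leP n : P n -> (n <= \dim {:E})%N.
  by move=> /asboolP[U [_ <-]]; apply: dimvS; apply: subvf.
case: (ex_maxnP exP leP) => n /asboolP[U [US dU]] maxn.
have SU e : j e \in S -> e \in U.
  move=> Se; suff /eqP -> : U == (U + <[e]>)%VS by rewrite memvE addvSr.
  rewrite eqEdim addvSl dU; apply: maxn; apply/asboolP.
  exists (U + <[e]>)%VS; split=> // _ /memv_addP[v Uv [_ /vlineP[a ->] ->]].
  rewrite inE rmorphD; apply: rpredD; first exact: US Uv.
  rewrite -mulr_algl rmorphM; apply: rpredM => //.
  by rewrite j_base; apply: KS; apply: valP.
have UE e : (e \in U) = (j e \in S) by apply/idP/idP; [exact: US|exact: SU].
have aU : is_aspace U.
  rewrite /is_aspace has_algid1 ?UE ?rmorph1 ?rpred1 //.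
  by apply/prodvP => a b; rewrite !UE => Sa Sb; rewrite rmorphM rpredM.
by exists (ASpace aU) => e; rewrite -UE.
Qed.

Lemma represents_closed (U : {subfield E}) :
  divring_closed (fun x => `[< exists2 e, e \in U & j e = x >] : bool).
Proof.
split=> [|x y|x y].
- by apply/asboolP; exists 1; rewrite ?rpred1 ?rmorph1.
- move=> /asboolP[a Ua <-] /asboolP[b Ub <-]; apply/asboolP.
  by exists (a - b); rewrite ?rpredB ?rmorphB.
- move=> /asboolP[a Ua <-] /asboolP[b Ub <-]; apply/asboolP.
  by exists (a / b); rewrite ?rpred_div ?fmorph_div.
Qed.

Lemma represents_adjoin (U : {subfield E}) (S : {pred L}) (s : seq E) :
  represents U S -> represents <<U & s>>%VS (adjoin_seq S (map j s)).
Proof.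
move=> US x; split.
  move=> /asboolP.
  (* The image of [<<U & s>>] is closed under the field operations and contains the generators,
     hence the subfield they generate. *)
  pose T : divringClosed L := HB.pack
    (fun x => `[< exists2 e, e \in <<U & s>>%VS & j e = x >] : bool)
    (GRing.isDivringClosed.Build L _ (represents_closed <<U & s>>%AS)).
  move=> /(_ T) /(_ _)/asboolP; apply => y Sy.
  apply/asboolP; case/orP: Sy => [/US[e Ue <-]|/mapP[e es ->]]; exists e => //.
    exact: (subvP (subv_adjoin_seq _ _)).
  exact: seqv_sub_adjoin.
case=> e + <-.
have subS : {subset S <= adjoin_seq S (map j s)}.
  by move=> y Sy; apply/asboolP => T; apply; rewrite !inE Sy.
(* Conversely, the preimage of the generated subfield is a subfield containing [U] and [s]. *)
have [V VE] : exists V : {subfield E},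
    forall e, (e \in V) <-> (j e \in adjoin_seq S (map j s)).
  apply: preimage_subfield => y Ky; apply: subS; apply/US.
  have /represents_base[e' e1 <-] := Ky; exists e' => //.
  exact: (subvP (sub1v _)).
suff /subvP UV : (<<U & s>> <= V)%VS by move=> /UV /VE.
apply/Fadjoin_seqP; split.
  by apply/subvP => y Uy; apply/VE/subS/US; exists y.
move=> y ys; apply/VE/asboolP => T; apply.
by rewrite !inE map_f ?orbT.
Qed.

Lemma represents_intermediate (T : {pred L}) (N : divringClosed L) (U : {vspace E}) :
  represents U T -> {subset K <= N} -> {subset N <= T} ->
  exists V : {subfield E}, represents V N.
Proof.
move=> UT KN NT; have [V VE] := preimage_subfield KN; exists V => x.
split=> [Nx|[e /VE Ne <-] //]; have /UT[e _ eE] := NT x Nx.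
by exists e => //; apply/VE; rewrite eE.
Qed.

End Models.

(** * The tower inside the Hahn field *)

Section HahnModel.
Variables (k : closedFieldType) (p : nat) (K : divringClosed (hahn k)).
Hypotheses (pcharkp : p \in [pchar k]) (p_gt2 : (2 < p)%N).
Hypothesis rfK : {subset rational_functions k <= K}.
Hypothesis al_notin : alpha k p \notin K.

Local Notation H := (hahn k).
Local Notation F0 := (subfield_type K).
Let iota : {rmorphism F0 -> H} := \val.

Let pcharHp : p \in [pchar H] := pchar_hahn pcharkp.

Lemma hconst_in c : hconst c \in K.
Proof.
by apply: rfK; apply/asboolP => T; apply; rewrite unfold_in; apply/asboolP; left; exists c.
Qed.

Lemma hvar_in : hvar \in K.
Proof. by apply: rfK; apply/asboolP => T; apply; rewrite unfold_in; apply/asboolP; right. Qed.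

Let z0 : F0 := Sub hvar^-1 (etrans (rpredV _ _) hvar_in).

Let pcharF0p : p \in [pchar F0].
Proof. by rewrite -(fmorph_pchar iota). Qed.

(** Primitive element theorem, with separability supplied by [theta_poly]: every [t] outside the
    roots of some nonzero [r] works. *)
Lemma hahn_primitive : exists t g (q1 q2 : {poly F0}),
  [/\ g = iota t * theta k p - eta k p, algebraicOver iota g,
      (map_poly iota q1).[g] = theta k p & (map_poly iota q2).[g] = eta k p].
Proof.
have [_ alE] := alpha_lt0_AS pcharkp.
have thE := theta_AS pcharkp; have etE := eta_AS pcharkp.
have th0 : root (map_poly iota (theta_poly p z0)) (theta k p).
  rewrite map_theta_poly rootE theta_polyE [wp p (theta k p)]thE.
  by rewrite [wp _ _]alE subrr.
have et0 : root (map_poly iota (eta_poly p z0)) (eta k p).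
  rewrite map_eta_poly; apply: (eta_poly_root pcharHp p_gt2 _ etE).
  exact: alE.
have nz_th : theta_poly p z0 != 0.
  exact: separable_poly_neq0 (separable_theta_poly pcharF0p z0).
have nz_et : eta_poly p z0 != 0.
  by rewrite -size_poly_eq0 (size_eta_poly pcharF0p p_gt2).
have [r nz_r PET] := large_field_PET nz_et et0 th0 (separable_theta_poly pcharF0p z0).
pose v : F0 := Sub hvar hvar_in.
have [t rt] : exists t, ~~ root r (iota t).
  (* Powers of [y] are distinct elements of [K], and [size r] of them is one more than the degree of
     [r]. *)
  pose ts := [seq iota (v ^+ n) | n <- seq.iota 0 (size r)].
  have uts : uniq ts.
    rewrite map_inj_uniq ?iota_uniq // => m n; rewrite !rmorphXn /= => e.
    have := congr1 (fun f : H => f n%:R) e.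
    rewrite -[hvar]/(monomial 1 1) !monomialX !monomialE !expr1n eqxx Num.Theory.eqr_nat.
    by case: eqP => // _ /eqP; rewrite eq_sym oner_eq0.
  have := max_poly_roots nz_r _ uts; rewrite size_map size_iota ltnn.
  case: (boolP (all (root r) ts)) => [_ /(_ isT)//|/allPn[_ /mapP[n _ ->]] rn _].
  by exists (v ^+ n).
have [[q2 q2E] [q1 q1E]] := PET t rt.
exists t, (iota t * theta k p - eta k p), q1, q2; split=> //.
have th_alg : algebraicOver iota (theta k p)
  by exact: ex_intro2 _ _ (theta_poly p z0) nz_th th0.
have et_alg : algebraicOver iota (eta k p)
  by exact: ex_intro2 _ _ (eta_poly p z0) nz_et et0.
exact: (algebraic_sub (algebraic_mul (algebraic_id iota t) th_alg) et_alg).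
Qed.

Lemma hahn_model : exists (E : splittingFieldType F0) (j : {rmorphism E -> H})
    (al th et : E),
  [/\ forall a : F0, j a%:A = val a, j al = alpha k p, j th = theta k p,
      j et = eta k p & <<<<<<1; al>>; et>>; th>>%VS = fullv].
Proof.
have [t [g [q1 [q2 [gE alg_g q1E q2E]]]]] := hahn_primitive.
have [E [j [g' [j_base jg gen_g]]]] := primitive_model alg_g.
have jpoly q : j (map_poly (in_alg E) q).[g'] = (map_poly iota q).[g].
  rewrite -horner_map jg /= -map_poly_comp; congr _.[_]; apply: eq_map_poly => a.
  exact: j_base.
pose th := (map_poly (in_alg E) q1).[g']; pose et := (map_poly (in_alg E) q2).[g'].
have jth : j th = theta k p by rewrite jpoly.
have jet : j et = eta k p by rewrite jpoly.
pose al := wp p th.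
have jal : j al = alpha k p.
  by rewrite /al /wp rmorphB rmorphXn /= jth (theta_AS pcharkp).
have genE : <<<<<<1; al>>; et>>; th>>%VS = fullv.
  apply/eqP; rewrite eqEsubv subvf -gen_g; apply/FadjoinP; split; first exact: sub1v.
  have -> : g' = t%:A * th - et.
    by apply: (fmorph_inj j); rewrite jg rmorphB rmorphM /= j_base jth jet.
  have base x : x \in (1%VS : {vspace E}) -> x \in <<<<<<1; al>>; et>>; th>>%VS.
    by apply: subvP; apply: sub1v.
  apply: rpredB; last by rewrite (subvP (subv_adjoin _ _)) ?memv_adjoin.
  by apply: rpredM; [apply: base; apply/vlineP; exists t | apply: memv_adjoin].
have pcharEp : p \in [pchar E] by rewrite -(fmorph_pchar j).
(* This constant supplies the [u] used to write the conjugates of [et]. *)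
have [c cE] : exists c : k, root ('X^p - 'X - 1%:P) c.
  apply/closed_rootP; rewrite (size_AS_poly pcharkp).
  by rewrite eqSS -lt0n (prime_gt0 (pcharf_prime pcharkp)).
have wc : wp p c = 1 by apply/eqP; rewrite -subr_eq0; move: cE; rewrite rootE !hornerE.
pose u : E := (Sub (hconst c) (hconst_in c) : F0)%:A.
have wu : wp p u = 1.
  apply: (fmorph_inj j); rewrite /wp rmorphB rmorphXn /= j_base /=.
  by rewrite -rmorphXn -rmorphB /= -/(wp p c) wc !rmorph1.
have jwp x y : wp p (j x) = j y -> wp p x = y.
  by move=> e; apply: (fmorph_inj j); rewrite -e /wp rmorphB rmorphXn.
have wal : wp p al = z0%:A.
  by apply: jwp; rewrite jal j_base; have [_] := alpha_lt0_AS pcharkp.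
have wet : wp p et = al ^+ 2.
  by apply: jwp; rewrite jet rmorphXn /= jal; apply: (eta_AS pcharkp).
(* Otherwise [alpha = wp theta] would lie in [K]. *)
have th1 : th \notin 1%VS.
  apply/negP => /vlineP[a thE]; move: al_notin.
  by rewrite -jal /al /wp rmorphB rmorphXn /= thE j_base rpredB ?rpredX ?(valP a).
have base a : a%:A \in (1%VS : {vspace E}) by apply/vlineP; exists a.
have splitE := splitting_field_tower pcharEp p_gt2 (base _) (base _) wu wal
  (erefl _) wet genE th1.
pose E' : splittingFieldType F0 := HB.pack (FieldExt.sort E)
  (FieldExt_isSplittingField.Build F0 E splitE).
by exists E', j, al, th, et.
Qed.

End HahnModel.

Theorem lemma4p6 (R : realType) (p : nat) (k : closedFieldType)
    (K : divringClosed (hahn k)) :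
  p \in [pchar k] -> (2 < p)%N ->
  {subset rational_functions k <= K} ->
  henselian K -> perfect_subfield K -> no_finite_limits R K ->
  let alpha := alpha k p in
  let theta := theta k p in
  let eta := eta k p in
  let L := adjoin_seq K [:: alpha] in
  let M := adjoin_seq L [:: eta] in
  let N := adjoin_seq L [:: theta; eta] in
  [/\ alpha ^+ p - alpha = hvar^-1,
      theta ^+ p - theta = alpha &
      eta ^+ p - eta = alpha ^+ 2] /\
  (exists (E : splittingFieldType (subfield_type K))
          (j : {rmorphism E -> hahn k}),
    [/\ models_extension N j,
        galois 1 {:E},
        ~~ abelian 'Gal({:E} / 1) &
        exists A B C : {group gal_of {:E}},
          [/\ cyclic_of_order p A, cyclic_of_order p B, cyclic_of_order p C &
              ((A \x B) ><| C = 'Gal({:E} / 1))%g]]) /\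
  (forall F : divringClosed (hahn k),
    (proper_subset K F /\ proper_subset F M) <-> F =i L).
Proof.
move=> pcharkp p_gt2 rfK _ _ nolim alpha theta eta L M N.
have [_ alE] := alpha_lt0_AS pcharkp.
have pcharHp := pchar_hahn pcharkp.
have no_root (e : k) c : e != 0 -> c \in K -> c ^+ p - c <> hconst e * hvar^-1.
  by move=> e0 Kc; apply: (no_root_AS_hvarV pcharkp e0 (nolim c Kc)).
have al_notin : alpha \notin K.
  by apply/negP => /(no_root 1 _ (oner_neq0 _)); apply; rewrite rmorph1 mul1r.
split; first by split; [exact: alE | exact: theta_AS | exact: eta_AS].
have [E [j [al [th [et [j_base jal jth jet genE]]]]]] :=
  hahn_model pcharkp p_gt2 rfK al_notin.
have pcharEp : p \in [pchar E] by rewrite -(fmorph_pchar j).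
have repK := represents_base j_base.
have repL : represents j <<1; al>>%VS L.
  by have := represents_adjoin j_base [:: al] repK; rewrite adjoin_seq1 /= jal.
have repM : represents j <<<<1; al>>; et>>%VS M.
  by have := represents_adjoin j_base [:: et] repL; rewrite adjoin_seq1 /= jet.
(* [N] adjoins [theta] before [eta], the model in the other order; [adjoinC] exchanges them. *)
have repN : represents j {:E} N.
  have := represents_adjoin j_base [:: th; et] repL.
  by rewrite adjoin_cons adjoin_seq1 /= adjoinC genE jth jet.
have wpE x y : wp p (j x) = j y -> wp p x = y.
  by move=> e; apply: (fmorph_inj j); rewrite -e /wp rmorphB rmorphXn.
have z_in : hvar^-1 \in K by rewrite rpredV hvar_in.
pose z : E := (Sub hvar^-1 z_in : subfield_type K)%:A.
have wal : wp p al = z by apply: wpE; rewrite jal j_base.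
have wth : wp p th = al by apply: wpE; rewrite jth jal; apply: theta_AS.
have wet : wp p et = al ^+ 2.
  by apply: wpE; rewrite jet rmorphXn /= jal; apply: eta_AS.
have const (x : E) n : wp p x = n%:R -> exists c, j x = hconst c.
  move=> xn; apply: (@hconst_of_root _ ('X^p - 'X - n%:R%:P)).
    by rewrite -size_poly_eq0 (size_AS_poly pcharkp).
  rewrite !rmorphB /= map_polyXn map_polyX map_polyC /= rmorph_nat rootE !hornerE.
  by rewrite -(rmorph_nat j) -xn /wp rmorphB rmorphXn subrr.
have z1 : z \in 1%VS by apply/vlineP; exists (Sub hvar^-1 z_in).
have const1 (x : E) n : wp p x = n%:R -> x \in 1%VS.
  by move=> /const[c xc]; apply/(represents_mem _ repK); rewrite xc hconst_in.
have al1 : al \notin 1%VS.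
  by apply/negP => /(represents_mem _ repK); rewrite jal; apply/negP.
(* The image of [f] is a constant [e], nonzero because [wp 0] is not 1, so this is the excluded
   equation with [e^p y^-1]. *)
have no_root1 (f c : E) : wp p f = 1 -> c \in 1%VS -> wp p c <> f ^+ p * z.
  move=> wf /(represents_mem _ repK) Kc cE.
  have [e fe] := const f 1%N wf.
  have e0 : e ^+ p != 0.
    rewrite expf_eq0 (prime_gt0 (pcharf_prime pcharkp)) /=.
    apply: contra_eq_neq wf => e0; rewrite eq_sym.
    have -> : f = 0 by apply: (fmorph_inj j); rewrite fe e0 !rmorph0.
    by rewrite /wp expr0n gtn_eqF ?prime_gt0 ?(pcharf_prime pcharkp) // subr0 oner_neq0.
  apply: (no_root _ _ e0 Kc).
  by rewrite rmorphXn /= -fe -rmorphXn -rmorphB /= -/(wp p c) cE rmorphM rmorphXn /= j_base.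
split.
  exists E, j; split.
  - split=> [a|x]; first exact: j_base.
    by split=> [/repN[e _ <-]|[e <-]]; [exists e | apply/repN; exists e; rewrite ?memvf].
  - exact: galois_tower pcharEp z1 wal wth wet genE.
  - exact: (gal_nonabelian pcharEp p_gt2 z1 wal wth wet genE const1 al1 no_root1).
  - exact: (gal_semidirect pcharEp p_gt2 z1 wal wth wet genE const1 al1 no_root1).
have etL := et_notin_al pcharEp p_gt2 z1 wal wth wet genE const1 al1 no_root1.
have uniqL := unique_subfield pcharEp p_gt2 z1 wal wth wet genE const1 al1 no_root1.
have subE S T U V (US : represents j U S) (VT : represents j V T) :
  {subset S <= T} <-> (U <= V)%VS := sub_represents US VT.
move=> F; split=> [[[KF FK] [FM MF]]|FL].
  have [U UF] := represents_intermediate j_base repM KF FM.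
  have UL : U = <<1; al>>%VS :> {vspace E}.
    apply: uniqL; first by apply/(subE _ _ _ _ UF repM).
      by apply: contra_notN FK => /eqP U1; apply/(subE _ _ _ _ UF repK); rewrite U1.
    by apply: contra_notN MF => /eqP U1; apply/(subE _ _ _ _ repM UF); rewrite U1.
  by rewrite UL in UF => x; apply/idP/idP => [/UF/repL|/repL/UF].
(* For [F = L] both inclusions are strict, by [al] outside [K] and [et] outside [L]. *)
have UF : represents j <<1; al>>%VS F by move=> x; rewrite FL; apply: repL.
split; split.
- by apply/(subE _ _ _ _ repK UF); apply: sub1v.
- move/(subE _ _ _ _ UF repK)/subvP => /(_ al (memv_adjoin _ _)).
  exact/negP.
- by apply/(subE _ _ _ _ UF repM); apply: subv_adjoin.
- move/(subE _ _ _ _ repM UF)/subvP => /(_ et (memv_adjoin _ _)).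
  exact/negP.
Qed.
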